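(* Let $\varrho=(r_n)_{n\in\mathbb{N}}$ be any sequence in $[0,1)$ converging to $1$. Then: (a) $\mathcal{U}_A(\mathbb{D},\varrho)\setminus \mathcal{U}_{Ces}(\mathbb{D},\mathbb{T})\neq\emptyset$; (b) $\mathcal{U}_A(\mathbb{D})\setminus \mathcal{U}_A(\mathbb{D},\varrho)\neq\emptyset$; (c) $\mathcal{U}_C(\mathbb{D})\setminus \mathcal{U}_A(\mathbb{D})\neq\emptyset$. In particular, the sets $\mathcal{U}_A(\mathbb{D},\varrho)$ and $\mathcal{U}(\mathbb{D},\mathbb{T})$ are not comparable, i.e. neither of them is included in the other.
   Context: $\mathbb{D}$ is the open unit disc of $\mathbb{C}$, $\mathbb{T}$ the unit circle, $H(\mathbb{D})$ the Fréchet space of holomorphic functions on $\mathbb{D}$ with the topology of uniform convergence on compact subsets. For a compact set $K$, $\mathcal{C}(K)$ is the space of continuous complex functions on $K$ with the uniform norm. For $f=\sum_k a_kz^k\in H(\mathbb{D})$, $S_n(f)=\sum_{k=0}^n a_kz^k$. - $\mathcal{U}_A(\mathbb{D},\varrho)$ ($\varrho$-Abel universal functions): the set of $f\in H(\mathbb{D})$ such that for every compact $K\subset\mathbb{T}$ with $K\neq\mathbb{T}$, the set $\{z\mapsto f(r_nz)|_K : n\in\mathbb{N}\}$ is dense in $\mathcal{C}(K)$. - $\mathcal{U}_A(\mathbb{D})$ (Abel universal functions): the set of $f\in H(\mathbb{D})$ such that for every compact $K\subset\mathbb{T}$ with $K\neq\mathbb{T}$ and every $h\in\mathcal{C}(K)$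 there is a sequence $(\rho_n)_n$ in $[0,1)$ tending to $1$ with $\sup_{\zeta\in K}|f(\rho_n\zeta)-h(\zeta)|\to 0$. - $\mathcal{U}(\mathbb{D},\mathbb{T})$: the set of $f\in H(\mathbb{D})$ such that for every compact $K\subset\mathbb{T}$ with $K\neq\mathbb{T}$ and every $\varphi\in\mathcal{C}(K)$ there is an increasing sequence of integers $(\lambda_n)_n$ with $\sup_{\zeta\in K}|S_{\lambda_n}(f)(\zeta)-\varphi(\zeta)|\to0$. - $\mathcal{U}_{Ces}(\mathbb{D},\mathbb{T})$: the set of $f\in H(\mathbb{D})$ such that for every compact $K\subset\mathbb{T}$ with $K\neq\mathbb{T}$ and every $\varphi\in\mathcal{C}(K)$ there is an increasing sequence of integers $(\lambda_n)_n$ with $\sup_{\zeta\in K}\left|\frac{1}{\lambda_n+1}\sum_{j=0}^{\lambda_n}S_j(f)(\zeta)-\varphi(\zeta)\right|\to0$. - $\mathcal{U}_C(\mathbb{D})$: the set of $f\in H(\mathbb{D})$ such that for every path to $\mathbb{T}$, i.e. every continuous $\gamma:[0,1)\to\mathbb{D}$ with $\gamma(r)\to z$ as $r\to1$ for some $z\in\mathbb{T}$, the cluster set $C_\gamma(f)=\{w\in\mathbb{C}: \exists (t_n)_n\subset[0,1),\ t_n\to1,\ f(\gamma(t_n))\to w\}$ is equal to $\mathbb{C}$. *)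

(* Defs.v *)
From HB Require Import structures.
From mathcomp Require Import all_boot all_order all_algebra.
From mathcomp Require Import all_classical all_reals all_analysis.
From mathcomp Require Import complex.

Set Implicit Arguments.
Unset Strict Implicit.
Unset Printing Implicit Defensive.

Import Order.TTheory GRing.Theory Num.Theory.
Import numFieldNormedType.Exports.

Local Open Scope classical_set_scope.
Local Open Scope ring_scope.
Local Open Scope complex_scope.

(* The complex plane as a normed space over itself; [derivable f z 1] is then
   complex differentiability at [z].                                          *)
Local Notation C R := (R[i]^o).

Definition unit_disc (R : realType) : set (C R) := [set z | `|z| < 1].

Definition unit_circle (R : realType) : set (C R) := [set z | `|z| = 1].

(* A function on the disc is represented by a total function; the values
   outside the disc play no role in the notions below.                        *)
Definition holo_disc (R : realType) : set (C R -> C R) :=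
  [set f | forall z, unit_disc z -> derivable f z 1].

Definition taylor_coef (R : realType) (f : C R -> C R) (k : nat) : C R :=
  (f^`(k))%classic 0 / k`!%:R.

Definition taylor_sum (R : realType) (f : C R -> C R) (n : nat) (z : C R)
    : C R :=
  \sum_(0 <= k < n.+1) taylor_coef f k * z ^+ k.

Definition cesaro_sum (R : realType) (f : C R -> C R) (n : nat) (z : C R)
    : C R :=
  (n.+1%:R)^-1 * \sum_(0 <= j < n.+1) taylor_sum f j z.

Definition proper_compact (R : realType) (K : set (C R)) : Prop :=
  [/\ compact K, K `<=` @unit_circle R & K <> @unit_circle R].

(* Representatives of C(K): only the values on K matter. *)
Definition continuous_on (R : realType) (K : set (C R)) : set (C R -> C R) :=
  [set h | {within K, continuous h}].

(* The uniform norm of C(K) is rendered by the topology of uniform convergence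
   on K: a subset of C(K) is dense in C(K) iff its closure in
   [{uniform` K -> C R}] contains C(K).                                       *)
Definition Abel_universal_along (R : realType) (r : nat -> R)
    : set (C R -> C R) :=
  [set f | holo_disc f /\
    forall K : set (C R), proper_compact K ->
      continuous_on K `<=`
      (closure (range (fun (n : nat) (z : C R) => f ((r n)%:C * z))
                 : set {uniform` K -> C R}))].

Definition Abel_universal (R : realType) : set (C R -> C R) :=
  [set f | holo_disc f /\
    forall K : set (C R), proper_compact K ->
    forall h : C R -> C R, continuous_on K h ->
    exists rho : nat -> R,
      [/\ forall n, 0 <= rho n < 1,
          rho n @[n --> \oo] --> (1 : R) &
          {uniform K, (fun (n : nat) (z : C R) => f ((rho n)%:C * z)) @ \oo
             --> h}]].

Definition Taylor_universal (R : realType) : set (C R -> C R) :=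
  [set f | holo_disc f /\
    forall K : set (C R), proper_compact K ->
    forall phi : C R -> C R, continuous_on K phi ->
    exists lambda : nat -> nat,
      {homo lambda : m n / (m < n)%N} /\
      {uniform K, (fun n : nat => taylor_sum f (lambda n)) @ \oo --> phi}].

Definition Cesaro_universal (R : realType) : set (C R -> C R) :=
  [set f | holo_disc f /\
    forall K : set (C R), proper_compact K ->
    forall phi : C R -> C R, continuous_on K phi ->
    exists lambda : nat -> nat,
      {homo lambda : m n / (m < n)%N} /\
      {uniform K, (fun n : nat => cesaro_sum f (lambda n)) @ \oo --> phi}].

Definition path_to_circle (R : realType) (gamma : R -> C R) : Prop :=
  [/\ forall t : R, 0 <= t < 1 -> unit_disc (gamma t),
      {within `[0, 1[, continuous gamma} &
      exists2 z : C R, unit_circle z & gamma t @[t --> (1 : R)^'-] --> z].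

Definition cluster_along (R : realType) (gamma : R -> C R) (f : C R -> C R)
    : set (C R) :=
  [set w | exists t : nat -> R,
    [/\ forall n, 0 <= t n < 1,
        t n @[n --> \oo] --> (1 : R) &
        f (gamma (t n)) @[n --> \oo] --> w]].

Definition cluster_universal (R : realType) : set (C R -> C R) :=
  [set f | holo_disc f /\
    forall gamma : R -> C R, path_to_circle gamma ->
      cluster_along gamma f = setT].

(* Main.v *)
Require Import Defs.
From mathcomp Require Import all_boot all_order all_algebra.
From mathcomp Require Import all_classical all_reals all_analysis.
From mathcomp Require Import complex.
From mathcomp Require Import ring lra zify.

(** Every function below is a limit, in the space of holomorphic functions of
    the disc, of polynomials [D 0, D 1, ...] built in stages: [D (j + 1) - D j]
    has a zero of high order at 0, is small on a disc whose radius tends to 1,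
    and brings the sum close to a prescribed polynomial on [x K], where [K] is a
    part of the circle that misses a point and [x] a radius close to (or equal
    to) 1. A polynomial correction [(phi - D) U] does this, where the polynomial
    [U] is small on the disc of radius [s < x] and close to 1 on [x K]
    ([cutoff], [circle_cutoff], [approximation_step]).

    [U] comes from Runge's method of pole pushing, carried out on polynomials
    only. For [s < t < x] the function [1 / (1 - (z / t)^n)] is close to 1 on
    the disc and to 0 on [x K]; its poles lie on the circle of radius [t], and
    each of them can be joined to infinity, along that circle and then along the
    ray through the missing point, without meeting the disc or [x K]. The disc
    is measured by the norm [pnorm s], the sum of the moduli of the coefficients
    weighted by the powers of [s]; thus Cauchy's integral formula is not needed,
    neither here nor for the limit ([disc_limit_is_derive], [disc_limit_taylor_coef]).
    The same method and the Bernstein polynomials give the density of the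
    polynomials in C(K) ([circle_weierstrass]), so that countably many tasks
    with rational data suffice ([task_dense]).

    (b), and the fact that a function of U(D,T) need not be Abel universal along
    [r], come from one function ([guarded_function]). There is a gap [(s, t)]
    free of the radii [r n]. After each correction, made on a circle of radius
    inside the gap or on the unit circle itself, a monomial [c z^m] is added
    that is tiny up to the middle of the gap and huge from [t] on. Hence
    [|F (r n)| >= 1] for all [n], which prevents universality along [r].

    (a) uses corrections on [r i K] ([shielded_function]), and between them
    terms [a z^k U'], where [U'] is 1 at 0 and so small on [r i K] that the sum
    of these terms stays small there however many there are. The coefficient of
    [z^k] can thus be changed freely, with three choices for [a], at least one
    of which makes both [|S_k(F)(1)|] and the modulus of the Cesaro mean of
    order [k] at 1 at least 1. This gives also that U_A(D,r) is not included in
    U(D,T).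

    For (c), compose the first function with [z |-> z^2]. Functions that come
    close to constants on arcs of circles have maximal cluster sets along all
    paths, because a path to the circle crosses these arcs
    ([radially_dense_cluster]); this property survives the composition, but an
    even function is not Abel universal ([even_not_Abel]). *)

Set Implicit Arguments.
Unset Strict Implicit.
Unset Printing Implicit Defensive.

Import Order.TTheory GRing.Theory Num.Theory.
Import numFieldNormedType.Exports.

Local Open Scope classical_set_scope.
Local Open Scope ring_scope.

Local Notation Re := complex.Re.
Local Notation Im := complex.Im.

(** * Modulus and coefficient norm *)

(** The modulus as a real number; the norm of the field [R[i]] takes its values
    in [R[i]] itself. *)
Definition cmod (R : realType) (z : R[i]) : R := Normc.normc z.

Section Modulus.
Variable R : realType.
Local Notation C := R[i].
Implicit Types (x y z : C) (r : R).

Lemma normE z : `|z| = (cmod z)%:C%C.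
Proof. by []. Qed.

Lemma cmodD x y : cmod (x + y) <= cmod x + cmod y.
Proof. by rewrite -lecR rmorphD /= -!normE ler_normD. Qed.

Lemma cmodM x y : cmod (x * y) = cmod x * cmod y.
Proof. exact: Normc.normcM. Qed.

Lemma cmodN x : cmod (- x) = cmod x.
Proof. by apply: complexI; rewrite -!normE normrN. Qed.

Lemma cmod_ge0 x : 0 <= cmod x.
Proof. by rewrite -ler0c -normE normr_ge0. Qed.

Lemma cmod0 : cmod (0 : C) = 0.
Proof. by apply: complexI; rewrite -normE normr0. Qed.

Lemma cmod1 : cmod (1 : C) = 1.
Proof. by apply: complexI; rewrite -normE normr1. Qed.

Lemma cmod_eq0 x : (cmod x == 0) = (x == 0).
Proof. by rewrite -(inj_eq (@complexI R)) -normE normr_eq0. Qed.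

Lemma cmod_gt0 x : (0 < cmod x) = (x != 0).
Proof. by rewrite lt_neqAle cmod_ge0 andbT eq_sym cmod_eq0. Qed.

Lemma cmodV x : cmod x^-1 = (cmod x)^-1.
Proof. exact: Normc.normcV. Qed.

Lemma cmodX x n : cmod (x ^+ n) = cmod x ^+ n.
Proof. by elim: n => [|n IH]; rewrite ?expr0 ?cmod1 // !exprS cmodM IH. Qed.

Lemma cmodr r : cmod (r%:C)%C = `|r|.
Proof. by rewrite /cmod /= expr0n /= addr0 sqrtr_sqr. Qed.

Lemma cmodr_ge0 r : 0 <= r -> cmod (r%:C)%C = r.
Proof. by move=> r0; rewrite cmodr ger0_norm. Qed.

Lemma cmod_nat n : cmod (n%:R : C) = n%:R.
Proof. by rewrite -(rmorph_nat (real_complex R)) cmodr_ge0 ?ler0n. Qed.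

Lemma cmodB x y : cmod (x - y) = cmod (y - x).
Proof. by rewrite -cmodN opprB. Qed.

Lemma cmodBD x y : cmod (x - y) <= cmod x + cmod y.
Proof. by rewrite (le_trans (cmodD _ _))// cmodN. Qed.

Lemma cmod_tri z x y : cmod (x - y) <= cmod (x - z) + cmod (z - y).
Proof. by rewrite -[x - y](subrKA z) cmodD. Qed.

Lemma cmod_rev x y : cmod x - cmod y <= cmod (x - y).
Proof. by rewrite lerBlDr -{1}[x](subrK y) cmodD. Qed.

Lemma cmod_sum I (r : seq I) (P : pred I) (F : I -> C) :
  cmod (\sum_(i <- r | P i) F i) <= \sum_(i <- r | P i) cmod (F i).
Proof.
elim/big_rec2: _ => [|i a b _ le_ba]; first by rewrite cmod0.
by rewrite (le_trans (cmodD _ _))// lerD2l.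
Qed.

Lemma cmod_sqr (a b : R) : cmod (a +i* b)%C ^+ 2 = a ^+ 2 + b ^+ 2.
Proof. by rewrite /cmod /= sqr_sqrtr // addr_ge0 ?sqr_ge0. Qed.

Lemma Re_le_cmod z : `|Re z| <= cmod z.
Proof. by rewrite -lecR; exact: normc_ge_Re. Qed.

Lemma Im_le_cmod z : `|Im z| <= cmod z.
Proof.
case: z => a b /=; rewrite -(ler_pXn2r (n := 2)) ?nnegrE ?cmod_ge0 //.
by rewrite cmod_sqr real_normK ?num_real // lerDr sqr_ge0.
Qed.

Lemma cmod_le_ReIm z : cmod z <= `|Re z| + `|Im z|.
Proof.
case: z => a b /=; rewrite -(ler_pXn2r (n := 2)) ?nnegrE ?cmod_ge0 ?addr_ge0 //.
rewrite cmod_sqr sqrrD !real_normK ?num_real //.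
by rewrite lerD2r lerDl mulrn_wge0 // mulr_ge0.
Qed.

Lemma norm_lt z r : (`|z| < r%:C%C) = (cmod z < r).
Proof. by rewrite normE ltcR. Qed.

End Modulus.

Section RealAux.
Variable R : realType.
Implicit Types (x e : R).

Lemma exprn_small x e : 0 <= x < 1 -> 0 < e ->
  exists N, forall n, (N <= n)%N -> x ^+ n <= e.
Proof.
move=> /andP[x0 x1] e0.
have /cvgrPdist_le/(_ e e0)[N _ HN] : (fun n => x ^+ n) @ \oo --> (0 : R).
  by apply: cvg_expr; rewrite ger0_norm.
exists N => n Nn; have := HN n Nn.
by rewrite sub0r normrN ger0_norm // exprn_ge0.
Qed.

Lemma exprn_large x e : 1 < x -> exists N, forall n, (N <= n)%N -> e <= x ^+ n.
Proof.
move=> x1.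
have e1 : 0 < `|e| + 1 by have := normr_ge0 e; lra.
have e0 : 0 < (`|e| + 1)^-1 by rewrite invr_gt0.
have x0 : 0 < x by lra.
have [|N HN] := @exprn_small x^-1 (`|e| + 1)^-1 _ e0.
  by rewrite invr_ge0 (ltW x0) invf_lt1.
exists N => n /HN; rewrite exprVn lef_pV2 ?posrE ?exprn_gt0 //.
by have := ler_norm e; lra.
Qed.

Lemma natr_mul_small (x y : R) : 0 < y -> exists n : nat, x <= n%:R * y.
Proof.
move=> y0; exists (Num.truncn (`|x| / y)).+1.
have h : 0 <= `|x| / y by rewrite divr_ge0 // ltW.
have /andP[_] := truncn_itv h.
rewrite ltr_pdivrMr // => /ltW; apply: le_trans; exact: ler_norm.
Qed.

End RealAux.

(** The norm of the Banach algebra of power series that converge absolutely on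
    the closed disc of radius [s], for polynomials. *)
Definition pnorm (R : realType) (s : R) (p : {poly R[i]}) : R :=
  \sum_(i < size p) cmod p`_i * s ^+ i.

Section PolyNorm.
Variables (R : realType) (s : R).
Hypothesis s0 : 0 <= s.
Local Notation C := R[i].
Implicit Types (p q : {poly C}) (z : C).

Lemma pnormE p n : (size p <= n)%N ->
  pnorm s p = \sum_(i < n) cmod p`_i * s ^+ i.
Proof.
move=> pn; rewrite /pnorm (big_ord_widen n (fun i => cmod p`_i * s ^+ i)) //.
rewrite big_mkcond; apply: eq_bigr => i _; case: ltnP => // ip.
by rewrite nth_default // cmod0 mul0r.
Qed.

Lemma pnorm_ge0 p : 0 <= pnorm s p.
Proof. by apply: sumr_ge0 => i _; rewrite mulr_ge0 ?cmod_ge0 ?exprn_ge0. Qed.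

Lemma pnorm0 : pnorm s 0 = 0.
Proof. by rewrite /pnorm size_poly0 big_ord0. Qed.

Lemma pnormC (c : C) : pnorm s c%:P = cmod c.
Proof.
by rewrite (pnormE (n := 1)) ?size_polyC_leq1 // big_ord1 coefC mulr1.
Qed.

Lemma pnorm1 : pnorm s 1 = 1.
Proof. by rewrite pnormC cmod1. Qed.

Lemma pnormD p q : pnorm s (p + q) <= pnorm s p + pnorm s q.
Proof.
set n := maxn (size p) (size q).
rewrite (pnormE (n := n)) ?size_polyD // (pnormE (n := n) (p := p)) ?leq_maxl //.
rewrite (pnormE (n := n) (p := q)) ?leq_maxr // -big_split /=.
apply: ler_sum => i _; rewrite -mulrDl ler_wpM2r ?exprn_ge0 //.
by rewrite coefD cmodD.
Qed.

Lemma pnormN p : pnorm s (- p) = pnorm s p.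
Proof.
by rewrite /pnorm size_polyN; apply: eq_bigr => i _; rewrite coefN cmodN.
Qed.

Lemma pnormB p q : pnorm s (p - q) <= pnorm s p + pnorm s q.
Proof. by rewrite (le_trans (pnormD _ _))// pnormN. Qed.

Lemma pnorm_cons p (c : C) : pnorm s (p * 'X + c%:P) = s * pnorm s p + cmod c.
Proof.
rewrite (pnormE (n := (size p).+1)); last first.
  rewrite (leq_trans (size_polyD _ _)) // geq_max (leq_trans (size_polyC_leq1 _)) //.
  by rewrite andbT (leq_trans (size_polyMleq _ _)) // size_polyX addnC.
rewrite big_ord_recl coefD coefMX coefC /= add0r expr0 mulr1 addrC; congr (_ + _).
rewrite /pnorm big_distrr /=; apply: eq_bigr => i _.
by rewrite coefD coefMX coefC /= addr0 exprS mulrCA.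
Qed.

Lemma pnormMX p : pnorm s (p * 'X) = s * pnorm s p.
Proof. by rewrite -[p * 'X]addr0 -polyC0 pnorm_cons cmod0 addr0. Qed.

Lemma pnormZ (c : C) p : pnorm s (c *: p) = cmod c * pnorm s p.
Proof.
rewrite (pnormE (n := size p)) ?size_scale_leq // big_distrr /=.
by apply: eq_bigr => i _; rewrite coefZ cmodM mulrA.
Qed.

Lemma pnormM p q : pnorm s (p * q) <= pnorm s p * pnorm s q.
Proof.
elim/poly_ind: p => [|p c IH]; first by rewrite mul0r pnorm0 mul0r.
rewrite pnorm_cons !mulrDl mulrAC (le_trans (pnormD _ _)) // pnormMX.
by rewrite mul_polyC pnormZ lerD2r -mulrA ler_wpM2l.
Qed.

Lemma pnormMXn p n : pnorm s (p * 'X^n) = s ^+ n * pnorm s p.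
Proof.
elim: n => [|n IH]; first by rewrite expr0 mulr1 mul1r.
by rewrite exprSr mulrA pnormMX IH exprS mulrA.
Qed.

Lemma pnormXn n : pnorm s 'X^n = s ^+ n.
Proof. by rewrite -['X^n]mul1r pnormMXn pnorm1 mulr1. Qed.

Lemma pnormX : pnorm s 'X = s.
Proof. by rewrite -(expr1 'X) pnormXn expr1. Qed.

Lemma cmod_horner_le p z : cmod z <= s -> cmod p.[z] <= pnorm s p.
Proof.
move=> zs; rewrite horner_coef (le_trans (cmod_sum _ _ _)) //.
apply: ler_sum => i _; rewrite cmodM cmodX ler_wpM2l ?cmod_ge0 //.
by rewrite lerXn2r ?nnegrE ?cmod_ge0.
Qed.

Lemma cmod_coef_le p i : cmod p`_i * s ^+ i <= pnorm s p.
Proof.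
case: (ltnP i (size p)) => ip; last first.
  by rewrite nth_default // cmod0 mul0r pnorm_ge0.
rewrite /pnorm (bigD1 (Ordinal ip)) //= lerDl; apply: sumr_ge0 => j _.
by rewrite mulr_ge0 ?cmod_ge0 ?exprn_ge0.
Qed.

Lemma pnorm_le_radius t p : s <= t -> pnorm s p <= pnorm t p.
Proof.
move=> st; apply: ler_sum => i _; rewrite ler_wpM2l ?cmod_ge0 //.
by rewrite lerXn2r ?nnegrE // (le_trans s0).
Qed.

Lemma pnorm_drop_poly m p : pnorm s (drop_poly m p * 'X^m) <= pnorm s p.
Proof.
have le_size : (size (drop_poly m p * 'X^m)%R <= size p + m)%N.
  rewrite (leq_trans (size_polyMleq _ _)) // size_polyXn size_drop_poly.
  by lia.
rewrite (pnormE le_size) (pnormE (leq_addr m (size p))); apply: ler_sum => i _.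
rewrite ler_wpM2r ?exprn_ge0 // coefMXn coef_drop_poly.
by case: ltnP => im; rewrite ?cmod0 ?cmod_ge0 // subnK.
Qed.

End PolyNorm.

(** * Runge's theorem by pole pushing *)

(** Submultiplicative seminorms on polynomials: the two examples are [pnorm s]
    and the modulus of the value at a point. *)
Definition algebra_seminorm (R : realType) (N : {poly R[i]} -> R) : Prop :=
  [/\ forall p q, N (p + q) <= N p + N q,
      forall p q, N (p * q) <= N p * N q,
      forall c, N c%:P = cmod c &
      forall p, 0 <= N p].

(** [X - b] is invertible in the completion of the polynomials for the family
    [F] of seminorms: [q] approaches [1 / (z - b)] uniformly in [F]. *)
Definition approx_inv (R : realType) (F : set ({poly R[i]} -> R)) (b : R[i]) :=
  forall e : R, 0 < e ->
    exists q : {poly R[i]}, forall N, F N -> N (('X - b%:P) * q - 1) <= e.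

(** The algebraic form of: [b] is at distance at least [d] from the set on
    which the seminorms of [F] live. *)
Definition far_from (R : realType) (F : set ({poly R[i]} -> R)) (d : R)
    (b : R[i]) : Prop :=
  forall N, F N -> forall q, d * N q <= N (('X - b%:P) * q).

Section PolePushing.
Variable R : realType.
Local Notation C := R[i].
Implicit Types (F : set ({poly C} -> R)) (N : {poly C} -> R).

Lemma pnorm_seminorm (s : R) : 0 <= s -> algebra_seminorm (@pnorm R s).
Proof.
move=> s0; split; [exact: pnormD|exact: pnormM|exact: pnormC|exact: pnorm_ge0].
Qed.

Lemma eval_seminorm (z : C) : algebra_seminorm (fun p : {poly C} => cmod p.[z]).
Proof.
split=> [p q|p q|c|p]; rewrite ?hornerE ?cmodD ?cmodM //; exact: cmod_ge0.
Qed.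

Section Seminorm.
Variable N : {poly C} -> R.
Hypothesis HN : algebra_seminorm N.

Lemma seminormD p q : N (p + q) <= N p + N q.
Proof. by case: HN. Qed.

Lemma seminormM p q : N (p * q) <= N p * N q.
Proof. by case: HN. Qed.

Lemma seminormC c : N c%:P = cmod c.
Proof. by case: HN. Qed.

Lemma seminorm_ge0 p : 0 <= N p.
Proof. by case: HN. Qed.

Lemma seminorm1 : N 1 = 1.
Proof. by rewrite seminormC cmod1. Qed.

Lemma seminormN p : N (- p) = N p.
Proof.
suff H q : N (- q) <= N q by apply/eqP; rewrite eq_le H -{1}[p]opprK H.
rewrite -mulN1r -polyCN (le_trans (seminormM _ _)) // seminormC cmodN cmod1.
by rewrite mul1r.
Qed.

Lemma seminormB p q : N (p - q) <= N p + N q.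
Proof. by rewrite (le_trans (seminormD _ _)) // seminormN. Qed.

Lemma seminormX p n : N (p ^+ n) <= N p ^+ n.
Proof.
elim: n => [|n IH]; first by rewrite !expr0 seminorm1.
rewrite !exprS (le_trans (seminormM _ _)) // ler_wpM2l // seminorm_ge0 //.
Qed.

End Seminorm.

(** If [p r] is close to 1, the geometric series of [1 - p r] turns [r] into an
    approximate inverse of [p] of arbitrary precision. *)
Lemma approx_inv_geometric F (p r : {poly C}) (t : R) :
  (forall N, F N -> algebra_seminorm N) ->
  0 <= t < 1 -> (forall N, F N -> N (1 - p * r) <= t) ->
  forall e : R, 0 < e -> exists q, forall N, F N -> N (p * q - 1) <= e.
Proof.
move=> HF t1 Ht e e0; have [n /(_ n (leqnn n)) Hn] := exprn_small t1 e0.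
set h := 1 - p * r in Ht.
exists (r * \sum_(i < n) h ^+ i) => N FN.
have -> : p * (r * \sum_(i < n) h ^+ i) - 1 = - h ^+ n.
  have /eqP := subrX1 h n; rewrite subr_eq => /eqP ->.
  by rewrite /h; set S := \sum_(i < n) _; ring.
rewrite (seminormN (HF _ FN)) (le_trans (seminormX (HF _ FN) _ _)) //.
rewrite (le_trans _ Hn) // lerXn2r ?nnegrE ?(seminorm_ge0 (HF _ FN)) ?Ht //.
by case/andP: t1.
Qed.

(** Invertibility of [X - b] propagates to all points within a quarter of the
    distance in the sense of [far_from]. *)
Lemma approx_inv_push F (d : R) (b b' : C) :
  (forall N, F N -> algebra_seminorm N) ->
  0 < d -> far_from F d b -> cmod (b' - b) <= d / 4 ->
  approx_inv F b -> approx_inv F b'.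
Proof.
move=> HF d0 far_b bb' Hb; have [|q Hq] := Hb (1 / 4); first by lra.
apply: (@approx_inv_geometric F _ q (9 / 16)) => //; first by lra.
move=> N FN; have HN := HF _ FN.
have -> : 1 - ('X - b'%:P) * q
    = (b' - b)%:P * q - (('X - b%:P) * q - 1).
  by rewrite polyCB; ring.
rewrite (le_trans (seminormB HN _ _)) //.
rewrite (le_trans (lerD (seminormM HN _ _) (Hq _ FN))) // (seminormC HN).
have q1 : d * N q <= 5 / 4.
  rewrite (le_trans (far_b _ FN q)) //.
  have := seminormD HN (('X - b%:P) * q - 1) 1; rewrite subrK (seminorm1 HN).
  by have := Hq _ FN; lra.
have : cmod (b' - b) * N q <= d / 4 * N q by rewrite ler_wpM2r ?seminorm_ge0.
lra.
Qed.

Lemma approx_inv_chain F (d : R) (b : nat -> C) n :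
  (forall N, F N -> algebra_seminorm N) -> 0 < d ->
  (forall i, (i < n)%N -> far_from F d (b i)) ->
  (forall i, (i < n)%N -> cmod (b i.+1 - b i) <= d / 4) ->
  approx_inv F (b 0%N) -> approx_inv F (b n).
Proof.
move=> HF d0; elim: n => // n IH far_b step Hb.
apply: (approx_inv_push HF d0 (far_b n _) (step n _)) => //.
by apply: IH => // i Hi; [apply: far_b|apply: step]; exact: ltnW.
Qed.

Lemma approx_inv_start F (b : C) :
  (forall N, F N -> algebra_seminorm N) ->
  (forall N, F N -> N 'X <= 1) -> cmod b = 2 -> approx_inv F b.
Proof.
move=> HF HX b2; have b0 : b != 0 by rewrite -cmod_gt0 b2.
apply: (@approx_inv_geometric F _ (- b^-1)%:P (1 / 2)) => //; first by lra.
move=> N FN; have HN := HF _ FN.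
have -> : 1 - ('X - b%:P) * (- b^-1)%:P = (b^-1)%:P * 'X.
  have <- : b%:P * (b^-1)%:P = 1 by rewrite -polyCM divff.
  by rewrite polyCN; ring.
rewrite (le_trans (seminormM HN _ _)) // (seminormC HN) cmodV b2.
by have := HX _ FN; lra.
Qed.

(** From the point [2 zeta] down the ray through the unimodular [zeta]. *)
Lemma approx_inv_ray F (d t : R) (zeta : C) :
  (forall N, F N -> algebra_seminorm N) ->
  (forall N, F N -> N 'X <= 1) -> cmod zeta = 1 -> 0 < d -> t <= 2 ->
  (forall u : R, t <= u <= 2 -> far_from F d (u%:C%C * zeta)) ->
  approx_inv F (t%:C%C * zeta).
Proof.
move=> HF HX z1 d0 t2 far_u.
have [n Hn] : exists n : nat, 2 - t <= n%:R * (d / 4).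
  by apply: natr_mul_small; lra.
pose b i : C := (2 - (2 - t) * (i%:R / n.+1%:R))%:C%C * zeta.
have Hb i : (i <= n.+1)%N -> 0 <= (i%:R / n.+1%:R : R) <= 1.
  move=> Hi; rewrite divr_ge0 ?ler0n //= ler_pdivrMr ?ltr0n // mul1r ler_nat //.
have -> : t%:C%C * zeta = b n.+1.
  by rewrite /b divff ?pnatr_eq0 // mulr1 opprB addrC subrK.
apply: (@approx_inv_chain F d) => // [i Hi|i Hi|].
- apply: far_u; have /andP[] := Hb i (ltnW Hi).
  set x := _ / _ => x0 x1; rewrite lerBrDl -lerBrDr.
  have : (2 - t) * x <= 2 - t by rewrite ler_piMr // subr_ge0.
  have : 0 <= (2 - t) * x by rewrite mulr_ge0 // subr_ge0.
  lra.
- rewrite /b -mulrBl cmodM z1 mulr1 -rmorphB cmodr.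
  have -> : 2 - (2 - t) * (i.+1%:R / n.+1%:R) - (2 - (2 - t) * (i%:R / n.+1%:R))
    = - ((2 - t) / n.+1%:R) :> R by rewrite -natr1; field; rewrite ?natr1 ?nat1r pnatr_eq0.
  rewrite normrN ger0_norm; last by rewrite divr_ge0 ?subr_ge0.
  rewrite ler_pdivrMr ?ltr0n // (le_trans Hn) // mulrC ler_wpM2l; [by []|lra|].
  by rewrite ler_nat.
- rewrite /b mul0r mulr0 subr0; apply: approx_inv_start => //.
  by rewrite cmodM z1 mulr1 cmodr_ge0 //; lra.
Qed.

(** A unimodular number has iterated square roots arbitrarily close to 1. *)
Lemma unimodular_root (k : nat) (v : C) : cmod v = 1 ->
  exists u : C, [/\ cmod u = 1, u ^+ (2 ^ k) = v &
    cmod (u - 1) ^+ 2 * 2 ^+ k <= 4].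
Proof.
move=> v1; elim: k => [|k [u [u1 uv Hu]]].
  exists v; split => //; rewrite expr0 mulr1.
  have := cmodBD v 1; rewrite v1 cmod1 => h.
  have -> : (4 : R) = (1 + 1) ^+ 2 by ring.
  by rewrite lerXn2r ?nnegrE ?cmod_ge0 //; lra.
have [w [w2 wRe]] : exists w : C, w ^+ 2 = u /\ 0 <= Re w.
  have [h|h] := leP 0 (Re (sqrtc u)).
    by exists (sqrtc u); rewrite sqr_sqrtc.
  exists (- sqrtc u); rewrite sqrrN sqr_sqrtc; split => //.
  by rewrite raddfN oppr_ge0 ltW.
have w1 : cmod w = 1.
  have : cmod w ^+ 2 = 1 by rewrite -cmodX w2.
  by move/eqP; rewrite sqrf_eq1 => /orP[/eqP//|/eqP]; have := cmod_ge0 w; lra.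
exists w; split => //; first by rewrite expnS exprM w2.
have -> : cmod (w - 1) ^+ 2 * 2 ^+ k.+1 = cmod (w - 1) ^+ 2 * 2 * 2 ^+ k :> R.
  by rewrite (exprS 2 k) mulrA.
apply: le_trans Hu; rewrite ler_wpM2r ?exprn_ge0 //.
have -> : u - 1 = (w - 1) * (w + 1) by rewrite -w2; ring.
rewrite cmodM exprMn ler_wpM2l ?exprn_ge0 ?cmod_ge0 //.
case: w wRe w1 {w2} => a b /= a0.
move=> /(congr1 (fun x => x ^+ 2)); rewrite !cmod_sqr expr1n => h.
by nra.
Qed.

(** Around the circle of radius [t], by steps of a fixed small rotation. *)
Lemma approx_inv_circle F (d t : R) (zeta w : C) :
  (forall N, F N -> algebra_seminorm N) -> 0 < d -> 0 < t <= 1 ->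
  cmod zeta = 1 -> cmod w = t ->
  (forall b, cmod b = t -> far_from F d b) ->
  approx_inv F (t%:C%C * zeta) -> approx_inv F w.
Proof.
move=> HF d0 /andP[t0 t1] z1 wt far_b Hz.
have tz0 : t%:C%C * zeta != 0 by rewrite -cmod_gt0 cmodM z1 mulr1 cmodr_ge0 // ltW.
have v1 : cmod (w / (t%:C%C * zeta)) = 1.
  by rewrite cmodM cmodV cmodM z1 wt mulr1 cmodr_ge0 ?ltW // divff // gt_eqF.
have [k Hk] : exists k, 4 / (d / 4) ^+ 2 <= (2 : R) ^+ k.
  have [|k Hk] := @exprn_large R 2 (4 / (d / 4) ^+ 2); first by lra.
  by exists k; exact: Hk.
have [u [u1 uv Hu]] := unimodular_root k v1.
have -> : w = t%:C%C * zeta * u ^+ (2 ^ k) by rewrite uv mulrC divfK.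
pose b i := t%:C%C * zeta * u ^+ i; rewrite -/(b _).
have bt i : cmod (b i) = t.
  by rewrite !cmodM cmodX u1 z1 expr1n !mulr1 cmodr_ge0 // ltW.
apply: (@approx_inv_chain F d) => // [i Hi|i Hi|].
- exact: far_b.
- have -> : b i.+1 - b i = b i * (u - 1) by rewrite /b exprSr; ring.
  rewrite cmodM bt.
  have : cmod (u - 1) <= d / 4.
    rewrite -(ler_pXn2r (n := 2)) ?nnegrE ?cmod_ge0 //; last by lra.
    have h : 0 < (d / 4) ^+ 2 by rewrite exprn_gt0 //; lra.
    move: Hk; rewrite ler_pdivrMr // => Hk.
    have h2 : 0 < (2 : R) ^+ k by rewrite exprn_gt0.
    by rewrite -(ler_pM2r h2) (le_trans Hu) // mulrC.
  by have := cmod_ge0 (u - 1); nra.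
- by rewrite /b expr0 mulr1.
Qed.

Lemma approx_inv_prod F (rs : seq C) :
  (forall N, F N -> algebra_seminorm N) ->
  {in rs, forall r, approx_inv F r} ->
  forall e : R, 0 < e -> exists q, forall N, F N ->
    N (\prod_(z <- rs) ('X - z%:P) * q - 1) <= e.
Proof.
move=> HF; elim: rs => [|r rs IH] Hrs e e0.
  exists 1 => N FN; rewrite big_nil mulr1 subrr -polyC0.
  by rewrite (seminormC (HF _ FN)) cmod0 ltW.
pose e1 := Num.min (e / 3) 1.
have e1_0 : 0 < e1 by rewrite lt_min ltr01 andbT; lra.
have e1e : e1 <= e / 3 by rewrite ge_min lexx.
have e11 : e1 <= 1 by rewrite ge_min lexx orbT.
have [|q Hq] := IH _ e1 e1_0.
  by move=> z zrs; apply: Hrs; rewrite in_cons zrs orbT.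
have [q2 Hq2] := Hrs r (mem_head _ _) e1 e1_0.
exists (q * q2) => N FN; have HN := HF _ FN; rewrite big_cons.
set P := \prod_(z <- rs) _; set A := 'X - r%:P.
have -> : A * P * (q * q2) - 1
    = (A * q2 - 1) * (P * q - 1) + (A * q2 - 1) + (P * q - 1) by ring.
have h1 := Hq _ FN; have h2 := Hq2 _ FN.
have h3 := seminorm_ge0 HN (A * q2 - 1); have h4 := seminorm_ge0 HN (P * q - 1).
rewrite (le_trans (seminormD HN _ _)) //.
have h5 := seminormD HN ((A * q2 - 1) * (P * q - 1)) (A * q2 - 1).
have h6 := seminormM HN (A * q2 - 1) (P * q - 1).
have h7 : N (A * q2 - 1) * N (P * q - 1) <= e1 * 1.
  by apply: ler_pM => //; exact: le_trans h1 e11.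
by rewrite -/P -/A in h1 h2 *; lra.
Qed.

Lemma far_from_eval (d : R) (b z : C) : d <= cmod (z - b) ->
  forall q : {poly C}, d * cmod q.[z] <= cmod (('X - b%:P) * q).[z].
Proof. by move=> dz q; rewrite !hornerE cmodM ler_wpM2r ?cmod_ge0. Qed.

(** The power series of [1 / (z - b)] has norm [1 / (|b| - s)]. *)
Lemma far_from_pnorm (d s : R) (b : C) : 0 <= s -> s + d <= cmod b ->
  forall q : {poly C}, d * pnorm s q <= pnorm s (('X - b%:P) * q).
Proof.
move=> s0 sb q.
have h : pnorm s (b *: q) <= pnorm s ('X * q) + pnorm s (('X - b%:P) * q).
  have -> : b *: q = 'X * q - ('X - b%:P) * q by rewrite -mul_polyC; ring.
  exact: pnormB.
move: h; rewrite pnormZ // ['X * q]mulrC pnormMX //.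
by have := pnorm_ge0 s0 q; nra.
Qed.

Lemma quotient_power_le (a b e x : R) (n : nat) : 0 < a -> 0 < e ->
  0 <= x -> 4 / e + 1 <= (b / a) ^+ n -> (b ^+ n - a ^+ n) * x <= 2 ->
  a ^+ n * x <= e / 2.
Proof.
move=> a0 e0 x0; have an0 : 0 < a ^+ n by rewrite exprn_gt0.
rewrite expr_div_n ler_pdivlMr // => ab bx.
have h : a ^+ n * (4 / e) * x <= 2.
  by apply: le_trans bx; rewrite ler_wpM2r //; lra.
have : a ^+ n * (4 / e) * x * e <= 2 * e by rewrite ler_wpM2r // ltW.
have -> : a ^+ n * (4 / e) * x * e = a ^+ n * x * 4.
  by field; rewrite gt_eqF.
by lra.
Qed.

(** If [q] is an approximate inverse of [z^n - t^n], then [t^n q + 1] is close to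
    [1 - 1 / (1 - (z / t)^n)]: small on the disc of radius [s < t], and close to
    1 where [|z| > t]. *)
Lemma inverse_power_disc (s t e : R) (n : nat) (q : {poly C}) :
  0 < s -> 0 < t -> 0 < e <= 1 -> 4 / e + 1 <= (t / s) ^+ n ->
  pnorm s (('X^n - (t%:C%C ^+ n)%:P) * q - 1) <= e / 2 ->
  pnorm s ((t%:C%C ^+ n) *: q + 1) <= e.
Proof.
move=> s_gt0 t0 /andP[e0 e1] Hn; have s0 := ltW s_gt0.
set E := _ * q - 1 => HE.
have h : pnorm s ((t%:C%C ^+ n) *: q) <= s ^+ n * pnorm s q + 1 + e / 2.
  have -> : (t%:C%C ^+ n) *: q = 'X^n * q - 1 - E.
    by rewrite /E -mul_polyC; ring.
  rewrite (le_trans (pnormB s0 _ _)) // lerD //.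
  rewrite (le_trans (pnormB s0 _ _)) // pnorm1 // lerD2r mulrC.
  by rewrite pnormMXn.
have -> : (t%:C%C ^+ n) *: q + 1 = 'X^n * q - E by rewrite /E -mul_polyC; ring.
rewrite (le_trans (pnormB s0 _ _)) // mulrC pnormMXn //.
move: h; rewrite pnormZ // cmodX cmodr_ge0 ?(ltW t0) // => h.
by have := quotient_power_le s_gt0 e0 (pnorm_ge0 s0 q) Hn; lra.
Qed.

Lemma inverse_power_point (t rho e : R) (n : nat) (q : {poly C}) (z : C) :
  0 < t -> t < rho -> rho <= cmod z -> 0 < e <= 1 ->
  4 / e + 1 <= (rho / t) ^+ n ->
  cmod (('X^n - (t%:C%C ^+ n)%:P) * q - 1).[z] <= e / 2 ->
  cmod (1 - ((t%:C%C ^+ n) *: q + 1).[z]) <= e.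
Proof.
move=> t0 trho rz /andP[e0 e1] Hn HE.
have -> : 1 - ((t%:C%C ^+ n) *: q + 1).[z] = - (t%:C%C ^+ n * q.[z]).
  by rewrite hornerD hornerZ -polyC1 hornerC opprD [LHS]addrC subrK.
rewrite cmodN cmodM cmodX cmodr_ge0 ?(ltW t0) //.
have rn : rho ^+ n <= cmod z ^+ n.
  by rewrite lerXn2r ?nnegrE ?cmod_ge0 //; lra.
have h : cmod ((z ^+ n - t%:C%C ^+ n) * q.[z]) <= 1 + e / 2.
  have -> : (z ^+ n - t%:C%C ^+ n) * q.[z]
      = 1 + (('X^n - (t%:C%C ^+ n)%:P) * q - 1).[z].
    rewrite hornerD hornerN -polyC1 hornerC hornerM hornerD hornerN.
    by rewrite hornerXn hornerC [RHS]addrC subrK.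
  by rewrite (le_trans (cmodD _ _)) // cmod1 lerD2l.
move: h; rewrite cmodM => h.
have h2 := cmod_rev (z ^+ n) (t%:C%C ^+ n).
rewrite !cmodX cmodr_ge0 ?(ltW t0) // in h2.
have h3 : (rho ^+ n - t ^+ n) * cmod q.[z]
    <= cmod (z ^+ n - t%:C%C ^+ n) * cmod q.[z].
  by rewrite ler_wpM2r ?cmod_ge0 //; lra.
by have := quotient_power_le t0 e0 (cmod_ge0 q.[z]) Hn; lra.
Qed.

(** The coefficients of low order of a polynomial that is small on the disc may
    be removed. *)
Lemma drop_low_order (s e : R) (V : {poly C}) (m : nat) (z : C) :
  0 < s <= 1 -> cmod z <= 1 -> pnorm s V <= e -> cmod (1 - V.[z]) <= e ->
  cmod (1 - (drop_poly m V * 'X^m).[z]) <= e * (1 + m%:R / s ^+ m).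
Proof.
move=> /andP[s0 s1] z1 Vs Vz; have sm_gt0 : 0 < s ^+ m by rewrite exprn_gt0.
have -> : 1 - (drop_poly m V * 'X^m).[z] = 1 - V.[z] + (take_poly m V).[z].
  by rewrite -[in V.[z]](poly_take_drop m V) hornerD; ring.
rewrite mulrDr mulr1 (le_trans (cmodD _ _)) // lerD //.
rewrite (le_trans (cmod_horner_le ler01 _ z1)) //.
rewrite (pnormE 1 (size_take_poly m V)).
have -> : e * (m%:R / s ^+ m) = \sum_(i < m) e / s ^+ m.
  by rewrite sumr_const card_ord mulrCA mulr_natl.
apply: ler_sum => i _; rewrite expr1n mulr1 coef_take_poly ltn_ord.
rewrite ler_pdivlMr //.
apply: le_trans (le_trans (cmod_coef_le (ltW s0) V i) Vs).
by rewrite ler_wpM2l ?cmod_ge0 // ler_wiXn2l ?(ltW s0) // ltnW.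
Qed.

(** Runge's theorem for a disc of radius [s] centred at 0 together with a set
    [K] that surrounds it but for a neighbourhood of a ray: a polynomial may be
    small on the disc (even with a zero of high order at 0) and close to 1 on
    [K]. *)
Lemma cutoff (K : set C) (zeta : C) (d s rho : R) :
  0 < s -> s < rho -> rho <= 1 -> cmod zeta = 1 -> 0 < d ->
  (forall z, K z -> rho <= cmod z <= 1) ->
  (forall z (t : R), K z -> 0 <= t <= 2 -> d <= cmod (z - t%:C%C * zeta)) ->
  forall (m : nat) (e : R), 0 < e -> exists W : {poly C},
    pnorm s (W * 'X^m) <= e /\
    forall z, K z -> cmod (1 - (W * 'X^m).[z]) <= e.
Proof.
move=> s_gt0 s_rho rho1 z1 d0 Kmod Kray m e e0.
have s0 := ltW s_gt0; have s1 : s <= 1 by lra.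
pose F := [set N | N = @pnorm R s \/
  exists2 z, K z & N = (fun p : {poly C} => cmod p.[z])].
have HF N : F N -> algebra_seminorm N.
  by case=> [->|[z _ ->]]; [exact: pnorm_seminorm|exact: eval_seminorm].
have HX N : F N -> N 'X <= 1.
  case=> [->|[z Kz ->]]; first by rewrite pnormX //; lra.
  by rewrite hornerX; case/andP: (Kmod z Kz).
pose t := (s + rho) / 2.
have [st trho] : s < t /\ t < rho by rewrite /t; split; lra.
have t0 : 0 < t by lra.
pose d1 := Num.min d (t - s).
have d1_0 : 0 < d1 by rewrite lt_min d0 subr_gt0.
have d1d : d1 <= d by rewrite ge_min lexx.
have d1s : d1 <= t - s by rewrite ge_min lexx orbT.
pose d2 := Num.min (t - s) (rho - t).
have d2_0 : 0 < d2 by rewrite lt_min !subr_gt0 st trho.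
have d2s : d2 <= t - s by rewrite ge_min lexx.
have d2r : d2 <= rho - t by rewrite ge_min lexx orbT.
have good_tz : approx_inv F (t%:C%C * zeta).
  apply: (@approx_inv_ray F d1) => // [|u /andP[tu u2] N [->|[z Kz ->]] q].
  - by lra.
  - apply: far_from_pnorm => //; rewrite cmodM z1 mulr1 cmodr_ge0; lra.
  - apply: far_from_eval; apply: le_trans d1d _; apply: Kray => //; lra.
have good_w w : cmod w = t -> approx_inv F w.
  move=> wt; apply: (approx_inv_circle HF d2_0 _ z1 wt _ good_tz).
    by apply/andP; split; lra.
  move=> b bt N [->|[z Kz ->]] q; first by apply: far_from_pnorm => //; lra.
  apply: far_from_eval; have := cmod_rev z b; have /andP[] := Kmod z Kz.
  by rewrite bt; lra.
(* the precision required before the low order coefficients are removed *)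
have [e1 [e1_0 e11 e1e]] : exists e1 : R,
    [/\ 0 < e1, e1 <= 1 & e1 * (1 + m%:R / s ^+ m) <= e].
  have h : 1 <= 1 + m%:R / s ^+ m by rewrite lerDl divr_ge0 ?exprn_ge0.
  have h0 := lt_le_trans ltr01 h.
  exists (Num.min 1 (e / (1 + m%:R / s ^+ m))); split.
  - by rewrite lt_min ltr01 divr_gt0.
  - by rewrite ge_min lexx.
  - by rewrite -ler_pdivlMr // ge_min lexx orbT.
have e1_le : e1 <= e.
  apply: le_trans e1e; rewrite ler_peMr ?(ltW e1_0) //.
  by rewrite lerDl divr_ge0 ?exprn_ge0.
(* n makes 1 / (1 - (z / t)^n) within e1 of 1 on the disc, of 0 on K *)
have [n [n0 Hn1 Hn2]] : exists n, [/\ (0 < n)%N,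
    4 / e1 + 1 <= (t / s) ^+ n & 4 / e1 + 1 <= (rho / t) ^+ n].
  have [|n1 Hn1] := @exprn_large R (t / s) (4 / e1 + 1).
    by rewrite ltr_pdivlMr // mul1r.
  have [|n2 Hn2] := @exprn_large R (rho / t) (4 / e1 + 1).
    by rewrite ltr_pdivlMr // mul1r.
  exists (n1 + n2).+1; split; first exact: ltn0Sn.
    by apply: Hn1; rewrite leqW // leq_addr.
  by apply: Hn2; rewrite leqW // leq_addl.
have [rs Hrs] := closed_field_poly_normal ('X^n - (t%:C%C ^+ n)%:P : {poly C}).
have lead1 : lead_coef ('X^n - (t%:C%C ^+ n)%:P : {poly C}) = 1.
  exact/monicP/monicXnsubC.
rewrite lead1 scale1r in Hrs.
have good_rs : {in rs, forall r, approx_inv F r}.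
  move=> w wrs; apply: good_w.
  have : root ('X^n - (t%:C%C ^+ n)%:P) w by rewrite Hrs root_prod_XsubC.
  rewrite rootE !hornerE subr_eq0 => /eqP wn.
  have : cmod w ^+ n = t ^+ n.
    by rewrite -cmodX wn cmodX cmodr_ge0 // ltW.
  by move/eqP; rewrite eqrXn2 ?cmod_ge0 ?ltW // => /eqP.
have e1_20 : 0 < e1 / 2 by lra.
have [q Hq] := approx_inv_prod HF good_rs e1_20.
rewrite -Hrs in Hq.
have e1_01 : 0 < e1 <= 1 by rewrite e1_0.
have Vs := inverse_power_disc s_gt0 t0 e1_01 Hn1 (Hq _ (or_introl erefl)).
exists (drop_poly m ((t%:C%C ^+ n) *: q + 1)); split.
  by rewrite (le_trans (pnorm_drop_poly s0 _ _)) // (le_trans Vs).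
move=> z Kz; have /andP[rz z_le1] := Kmod z Kz.
apply: le_trans e1e; apply: drop_low_order => //; first by rewrite s_gt0.
apply: (inverse_power_point t0 trho rz e1_01 Hn2).
exact: (Hq _ (or_intror (ex_intro2 _ _ z Kz erefl))).
Qed.

End PolePushing.

(** * Polynomial approximation on parts of the circle *)

(** [K] is a part of the unit circle that stays at distance at least [e] from
    the point [zeta] of the circle. *)
Definition avoids (R : realType) (zeta : R[i]) (e : R) (K : set R[i]) : Prop :=
  [/\ cmod zeta = 1, 0 < e &
      forall z, K z -> cmod z = 1 /\ e <= cmod (z - zeta)].

Section CircleSets.
Variable R : realType.
Local Notation C := R[i].

(** The ray through [zeta] stays away from [r K]. *)
Lemma avoids_ray (zeta : C) (e : R) (K : set C) (r t : R) (z : C) :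
  avoids zeta e K -> 0 < r -> 0 <= t -> K z ->
  r * e / 2 <= cmod (r%:C%C * z - t%:C%C * zeta).
Proof.
move=> [z1 e0 HK] r0 t0 /HK [zz ez]; have rr := ltW r0.
have h1 : r * e <= cmod (r%:C%C * z - r%:C%C * zeta).
  by rewrite -mulrBr cmodM cmodr_ge0 // ler_wpM2l.
have h2 := cmod_tri (t%:C%C * zeta) (r%:C%C * z) (r%:C%C * zeta).
have h3 : cmod (t%:C%C * zeta - r%:C%C * zeta) = `|t - r|.
  by rewrite -mulrBl cmodM z1 mulr1 -rmorphB cmodr.
have h4 := cmod_rev (r%:C%C * z) (t%:C%C * zeta).
have h5 := cmod_rev (t%:C%C * zeta) (r%:C%C * z).
rewrite (cmodB (t%:C%C * zeta)) in h5.
rewrite !cmodM !cmodr_ge0 // z1 zz !mulr1 in h4 h5.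
have h6 : `|t - r| <= cmod (r%:C%C * z - t%:C%C * zeta).
  by rewrite ler_norml; apply/andP; split; lra.
lra.
Qed.

(** [cutoff] for the set [r K]. *)
Lemma circle_cutoff (K : set C) (zeta : C) (e s r : R) :
  avoids zeta e K -> 0 < s -> s < r -> r <= 1 ->
  forall (m : nat) (d : R), 0 < d -> exists W : {poly C},
    pnorm s (W * 'X^m) <= d /\
    forall z, K z -> cmod (1 - (W * 'X^m).[r%:C%C * z]) <= d.
Proof.
move=> HK s0 sr r1 m d d0; have r0 : 0 < r by lra.
have [z1 e0 HK2] := HK.
have re0 : 0 < r * e / 2 by rewrite divr_gt0 // mulr_gt0.
have [|z t [w Kw <-] /andP[t0 _]|W [HW1 HW2]] :=
    @cutoff R [set (r%:C%C * z) | z in K] zeta (r * e / 2) s r s0 sr r1 z1 re0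
      _ _ m d d0.
- move=> z [w /HK2[w1 _] <-].
  by rewrite cmodM w1 mulr1 cmodr_ge0 ?lexx // ltW.
- exact: avoids_ray HK _ _ _.
by exists W; split => // z Kz; apply: HW2; exists z.
Qed.

(** The Cauchy kernel at [zeta] is a uniform limit of polynomials on [K]. *)
Lemma circle_pole (K : set C) (zeta : C) (e : R) : avoids zeta e K ->
  forall d : R, 0 < d -> exists q : {poly C},
    forall z, K z -> cmod ((z - zeta) * q.[z] - 1) <= d.
Proof.
move=> HK d d0; have [z1 e0 HK2] := HK.
pose F := [set N | exists2 z, K z & N = (fun p : {poly C} => cmod p.[z])].
have HF N : F N -> algebra_seminorm N by case=> [z _ ->]; exact: eval_seminorm.
have HX N : F N -> N 'X <= 1.
  by case=> [z Kz ->]; rewrite hornerX; case: (HK2 z Kz) => ->.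
have e20 : 0 < e / 2 by lra.
have [|u u1 N [z Kz ->] p|q Hq] :=
    @approx_inv_ray R F (e / 2) 1 zeta HF HX z1 e20 _ _ d d0.
- by lra.
- apply: far_from_eval.
  have -> : z = 1%:C%C * z by rewrite rmorph1 mul1r.
  have -> : e / 2 = 1 * e / 2 by rewrite mul1r.
  by apply: (avoids_ray HK) => //; lra.
- exists q => z Kz.
  have := Hq _ (ex_intro2 _ _ z Kz erefl); rewrite rmorph1 mul1r.
  by rewrite hornerD hornerN -polyC1 hornerC hornerM hornerXsubC.
Qed.

(** The Cayley transform, from the circle without [zeta] to the real line. *)
Definition cayley (zeta z : C) : R :=
  - Im (z / zeta) / (1 - Re (z / zeta)).

Lemma cayleyE (zeta z : C) : cmod zeta = 1 -> cmod z = 1 -> z != zeta ->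
  (cayley zeta z)%:C%C * (zeta - z) = 'i%C * (zeta + z).
Proof.
move=> z1 zz zzeta; have zeta0 : zeta != 0 by rewrite -cmod_gt0 z1.
have [a az] : exists a, z = a * zeta by exists (z / zeta); rewrite divfK.
have a1 : cmod a = 1 by move: zz; rewrite az cmodM z1 mulr1.
have an1 : a != 1 by apply: contra zzeta => /eqP a_eq; rewrite az a_eq mul1r.
rewrite /cayley az mulfK //.
have -> : zeta - a * zeta = (1 - a) * zeta by ring.
have -> : zeta + a * zeta = (1 + a) * zeta by ring.
rewrite !mulrA; congr (_ * _).
case: a a1 an1 {az} => x y /(congr1 (fun x => x ^+ 2)).
rewrite cmod_sqr expr1n => h an1.
have x1 : 1 - x != 0.
  apply: contra an1; rewrite subr_eq0 => /eqP x1.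
  rewrite -x1 expr1n in h *.
  have : y ^+ 2 = 0 by lra.
  by move/eqP; rewrite expf_eq0 /= => /eqP ->.
apply/eqP; rewrite eq_complex /=; apply/andP; split; apply/eqP.
- by field.
- have -> : - y / (1 - x) * (0 - y) + 0 * (1 - x) = y ^+ 2 / (1 - x).
    by field.
  have -> : y ^+ 2 = (1 - x) * (1 + x).
    by apply: (addrI (x ^+ 2)); rewrite h; ring.
  by field.
Qed.

Lemma cayley_le (zeta z : C) (e : R) : cmod zeta = 1 -> cmod z = 1 -> 0 < e ->
  e <= cmod (z - zeta) -> `|cayley zeta z| <= 2 / e.
Proof.
move=> z1 zz e0 ez.
have zz' : z != zeta.
  by apply: contraTneq ez => ->; rewrite subrr cmod0 -ltNge.
have := congr1 (@cmod R) (cayleyE z1 zz zz').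
rewrite !cmodM cmodr (cmodB zeta) => h.
have hi : cmod 'i%C = 1 :> R by rewrite /cmod /= expr0n /= add0r expr1n sqrtr1.
have := cmodD zeta z; rewrite z1 zz hi mul1r in h * => h2.
rewrite ler_pdivlMr //.
have : `|cayley zeta z| * e <= `|cayley zeta z| * cmod (z - zeta).
  by rewrite ler_wpM2l.
by lra.
Qed.

(** The inverse of the Cayley transform is Lipschitz. *)
Lemma cayley_inv_lip (zeta z w : C) : cmod zeta = 1 -> cmod z = 1 ->
  cmod w = 1 -> z != zeta -> w != zeta ->
  cmod (z - w) <= 2 * `|cayley zeta z - cayley zeta w|.
Proof.
move=> z1 zz ww zn wn.
have hz := cayleyE z1 zz zn; have hw := cayleyE z1 ww wn.
set X := cayley zeta z in hz *; set Y := cayley zeta w in hw *.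
have hi : cmod 'i%C = 1 :> R by rewrite /cmod /= expr0n /= add0r expr1n sqrtr1.
have hX : 1 <= cmod (X%:C%C + 'i%C).
  by have := Im_le_cmod (X%:C%C + 'i%C); rewrite /= add0r normr1.
have hY : 1 <= cmod (Y%:C%C + 'i%C).
  by have := Im_le_cmod (Y%:C%C + 'i%C); rewrite /= add0r normr1.
have key : (z - w) * (X%:C%C + 'i%C) * (Y%:C%C + 'i%C)
    = zeta * (2 * 'i%C) * (X - Y)%:C%C.
  have ez : z * (X%:C%C + 'i%C) = zeta * (X%:C%C - 'i%C).
    apply/eqP; rewrite -subr_eq0; apply/eqP.
    transitivity ('i%C * (zeta + z) - X%:C%C * (zeta - z)); first by ring.
    by rewrite -hz subrr.
  have ew : w * (Y%:C%C + 'i%C) = zeta * (Y%:C%C - 'i%C).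
    apply/eqP; rewrite -subr_eq0; apply/eqP.
    transitivity ('i%C * (zeta + w) - Y%:C%C * (zeta - w)); first by ring.
    by rewrite -hw subrr.
  have -> : (z - w) * (X%:C%C + 'i%C) * (Y%:C%C + 'i%C)
    = z * (X%:C%C + 'i%C) * (Y%:C%C + 'i%C) - w * (Y%:C%C + 'i%C) * (X%:C%C + 'i%C)
    by ring.
  by rewrite ez ew rmorphB /=; ring.
have := congr1 (@cmod R) key.
rewrite !cmodM cmod_nat hi z1 cmodr !mul1r !mulr1 => <-.
rewrite -[X in X <= _]mulr1; apply: ler_pM; rewrite ?cmod_ge0 ?mulr_ge0 ?cmod_ge0 //.
by rewrite ler_peMr ?cmod_ge0.
Qed.

Lemma poly_lip (P : {poly C}) : exists2 L : R, 0 <= L &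
  forall x y, cmod x <= 2 -> cmod y <= 2 ->
    cmod (P.[x] - P.[y]) <= L * cmod (x - y).
Proof.
elim/poly_ind: P => [|p c [L L0 IH]].
  by exists 0 => // x y _ _; rewrite !horner0 subrr cmod0 mul0r.
have p0 : 0 <= pnorm 2 p by exact: pnorm_ge0.
exists (L * 2 + pnorm 2 p) => [|x y hx hy]; first by rewrite addr_ge0 // mulr_ge0.
have -> : (p * 'X + c%:P).[x] - (p * 'X + c%:P).[y]
    = (p.[x] - p.[y]) * x + p.[y] * (x - y) by rewrite !hornerE; ring.
rewrite (le_trans (cmodD _ _)) // !cmodM mulrDl; apply: lerD.
  rewrite mulrAC; apply: ler_pM; rewrite ?cmod_ge0 //; exact: IH.
rewrite ler_wpM2r ?cmod_ge0 //; apply: cmod_horner_le => //; lra.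
Qed.

(** Bernstein polynomials of a sequence of values at the nodes, defined by the
    recursion on the degree (de Casteljau); [bernR] is the same operator on
    real functions, used for its positivity. *)
Fixpoint bern (n : nat) (f : nat -> C) : {poly C} :=
  if n is m.+1 then (1 - 'X) * bern m f + 'X * bern m (fun k => f k.+1)
  else (f 0%N)%:P.

Fixpoint bernR (n : nat) (g : nat -> R) (u : R) : R :=
  if n is m.+1 then (1 - u) * bernR m g u + u * bernR m (fun k => g k.+1) u
  else g 0%N.

Lemma bern_le n f g u : 0 <= u <= 1 -> (forall k, cmod (f k) <= g k) ->
  cmod (bern n f).[u%:C%C] <= bernR n g u.
Proof.
move=> /andP[u0 u1]; elim: n f g => [|n IH] f g fg /=; first by rewrite hornerC.
have -> : ((1 - 'X) * bern n f + 'X * bern n (fun k => f k.+1)).[u%:C%C]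
  = (1 - u)%:C%C * (bern n f).[u%:C%C]
    + u%:C%C * (bern n (fun k => f k.+1)).[u%:C%C].
  by rewrite !hornerE rmorphB rmorph1.
rewrite (le_trans (cmodD _ _)) // !cmodM !cmodr_ge0 ?subr_ge0 //.
by apply: lerD; rewrite ler_wpM2l ?subr_ge0 //; apply: IH => // k; exact: fg.
Qed.

Lemma bern_sub_const n f c u :
  (bern n (fun k => f k - c)).[u] = (bern n f).[u] - c.
Proof.
elim: n f => [|n IH] f /=; first by rewrite !hornerC.
by rewrite !hornerE /= !IH; ring.
Qed.

(** The mean and the variance of the binomial law. *)
Lemma bernR_moment n (a c d u : R) :
  bernR n (fun k => c + d * (k%:R + a) ^+ 2) u
  = c + d * ((n%:R * u + a) ^+ 2 + n%:R * u * (1 - u)).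
Proof.
elim: n a => [|n IH] a /=; first by rewrite !mul0r addr0.
rewrite IH.
have -> : bernR n (fun k => c + d * (k.+1%:R + a) ^+ 2) u
  = bernR n (fun k => c + d * (k%:R + (1 + a)) ^+ 2) u.
  by congr bernR; apply/funext => k; rewrite -natr1 addrA.
by rewrite IH -natr1; ring.
Qed.

(** Bernstein's theorem for a function of a real coordinate [u] of the points of
    [K]; the values of [u] need not fill the unit interval. *)
Lemma bernstein_approx (K : set C) (u : C -> R) (phi : C -> C) (B d e : R) :
  (forall z, K z -> 0 <= u z <= 1) -> (forall z, K z -> cmod (phi z) <= B) ->
  0 < d -> 0 < e ->
  (forall z w, K z -> K w -> `|u z - u w| < 2 * d -> cmod (phi z - phi w) <= e) ->
  exists P : {poly C}, forall z, K z ->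
    cmod (P.[(u z)%:C%C] - phi z) <= 2 * e.
Proof.
move=> u01 HB d0 e0 Hphi.
have [[z0 Kz0]|K0] := pselect (exists z, K z); last first.
  by exists 0 => z Kz; exfalso; apply: K0; exists z.
have B0 : 0 <= B by apply: le_trans (HB _ Kz0); exact: cmod_ge0.
have [n n0 Hn] : exists2 n : nat, (0 < n)%N & 2 * B / d ^+ 2 <= n%:R * e.
  have [n Hn] := natr_mul_small (2 * B / d ^+ 2) e0.
  exists n.+1 => //; apply: (le_trans Hn); rewrite ler_wpM2r //; first by lra.
  by rewrite ler_nat.
have nR0 : 0 < n%:R :> R by rewrite ltr0n.
(* the value at the node k / n is taken at a point of K close to it, if any:
   no extension of phi is needed *)
pose v k : C := if pselect (exists2 w, K w & `|k%:R / n%:R - u w| < d) is left H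
  then phi (sval (cid2 H)) else 0.
have vE k z : K z -> cmod (v k - phi z)
    <= e + 2 * B / (n%:R * d) ^+ 2 * (k%:R + - (n%:R * u z)) ^+ 2.
  move=> Kz; have nd0 : 0 < (n%:R * d) ^+ 2 by rewrite exprn_gt0 // mulr_gt0.
  have h0 : 0 <= 2 * B / (n%:R * d) ^+ 2 * (k%:R + - (n%:R * u z)) ^+ 2.
    by rewrite mulr_ge0 ?sqr_ge0 // divr_ge0 ?(ltW nd0) // mulr_ge0.
  have [close|far] := ltP `|k%:R / n%:R - u z| d.
    rewrite /v; case: pselect => [H|]; last by case; exists z.
    case: (cid2 H) => w Kw wk /=.
    suff : cmod (phi w - phi z) <= e by lra.
    apply: Hphi => //.
    have -> : u w - u z = - (k%:R / n%:R - u w) + (k%:R / n%:R - u z) by ring.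
    by rewrite (le_lt_trans (ler_normD _ _)) // normrN; lra.
  have vB : cmod (v k) <= B.
    rewrite /v; case: pselect => [H|_]; last by rewrite cmod0.
    by case: (cid2 H) => w Kw wk /=; exact: HB.
  rewrite (le_trans (cmodBD _ _)) //.
  suff : 2 * B <= 2 * B / (n%:R * d) ^+ 2 * (k%:R + - (n%:R * u z)) ^+ 2.
    by have := HB z Kz; lra.
  rewrite -mulrA ler_peMr ?mulr_ge0 // mulrC ler_pdivlMr // mul1r.
  have -> : k%:R + - (n%:R * u z) = n%:R * (k%:R / n%:R - u z).
    by field; rewrite gt_eqF.
  rewrite !exprMn ler_wpM2l ?sqr_ge0 //.
  rewrite -[X in _ <= X]real_normK ?num_real // lerXn2r ?nnegrE //.
  exact: ltW.
exists (bern n v) => z Kz; rewrite -bern_sub_const.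
rewrite (le_trans (bern_le n (u01 z Kz) (fun k => vE k z Kz))) //.
rewrite bernR_moment subrr expr0n /= add0r.
have -> : 2 * B / (n%:R * d) ^+ 2 * (n%:R * u z * (1 - u z))
  = 2 * B / d ^+ 2 / n%:R * (u z * (1 - u z)).
  by field; rewrite !gt_eqF.
have h1 : 2 * B / d ^+ 2 / n%:R <= e.
  by rewrite ler_pdivrMr // [_ * n%:R]mulrC.
have h2 : 0 <= 2 * B / d ^+ 2 / n%:R.
  by rewrite !divr_ge0 ?mulr_ge0 ?exprn_ge0 ?(ltW d0).
have /andP[u0 u1] := u01 z Kz.
have h3 : u z * (1 - u z) <= 1 by nra.
have h4 : 2 * B / d ^+ 2 / n%:R * (u z * (1 - u z)) <= e * 1.
  by apply: ler_pM => //; rewrite mulr_ge0 // subr_ge0.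
by lra.
Qed.

(** The Cayley transform rescaled from the interval [[-M, M]] to the unit
    interval. *)
Definition circle_coord (zeta : C) (M : R) (z : C) : R :=
  (cayley zeta z + M) / (2 * M).

Lemma circle_coord_approx (K : set C) (zeta : C) (e : R) : avoids zeta e K ->
  forall d : R, 0 < d -> exists a : {poly C}, forall z, K z ->
    cmod ((circle_coord zeta (2 / e) z)%:C%C - a.[z]) <= d.
Proof.
move=> HK d d0; have [z1 e0 HK2] := HK.
have [M ME] : exists M, M = 2 / e by eexists.
have M0 : 0 < M by rewrite ME divr_gt0.
have [q Hq] := circle_pole HK d0.
exists (((2 * M)^-1)%:C%C *:
  ((- 'i%C) *: (('X + zeta%:P) * q) + (M%:C%C)%:P)) => z Kz.
have [zz ez] := HK2 z Kz.
have zneq : z != zeta.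
  by apply: contraTneq ez => ->; rewrite subrr cmod0 -ltNge.
have zn : z - zeta != 0 by rewrite subr_eq0.
have cz : (cayley zeta z)%:C%C = - 'i%C * (zeta + z) / (z - zeta).
  apply: (mulIf zn); rewrite divfK //.
  have := cayleyE z1 zz zneq.
  by rewrite -(opprB z) mulrN => /(congr1 -%R); rewrite opprK => ->; ring.
rewrite -ME /circle_coord; set a : {poly C} := _ *: _.
have -> : ((cayley zeta z + M) / (2 * M))%:C%C - a.[z] = ((2 * M)^-1)%:C%C *
   ('i%C * (zeta + z) / (z - zeta) * ((z - zeta) * q.[z] - 1)).
  rewrite mulrC rmorphM rmorphD /= cz /a hornerZ hornerD hornerZ hornerM.
  rewrite hornerD hornerX !hornerC.
  field; rewrite zn /=; apply/eqP => M_eq; move: M0.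
  by rewrite (complexI (M_eq : M%:C%C = 0%:C%C)) ltxx.
rewrite !cmodM cmodV cmodr_ge0 ?invr_ge0 ?mulr_ge0 ?(ltW M0) //.
have hi : cmod 'i%C = 1 :> R by rewrite /cmod /= expr0n /= add0r expr1n sqrtr1.
rewrite hi mul1r.
have h1 := Hq z Kz.
have h2 : cmod (zeta + z) <= 2 by rewrite (le_trans (cmodD _ _)) // z1 zz; lra.
have h3 : (2 * M)^-1 * (cmod (zeta + z) / cmod (z - zeta)) <= 1.
  have -> : (2 * M)^-1 = e / 4 by rewrite ME; field; rewrite gt_eqF.
  have h : cmod (zeta + z) / cmod (z - zeta) <= 2 / e.
    by apply: ler_pM; rewrite ?invr_ge0 ?cmod_ge0 // lef_pV2 ?posrE //;
      exact: lt_le_trans e0 ez.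
  have : e / 4 * (cmod (zeta + z) / cmod (z - zeta)) <= e / 4 * (2 / e).
    by rewrite ler_wpM2l //; lra.
  have -> : e / 4 * (2 / e) = 1 / 2 by field; rewrite gt_eqF.
  by lra.
rewrite mulrA -[X in _ <= X]mul1r; apply: ler_pM; rewrite ?cmod_ge0 //.
by rewrite mulr_ge0 ?divr_ge0 ?cmod_ge0 // invr_ge0 mulr_ge0 // ltW.
Qed.

(** Polynomials are dense in the continuous functions on a part of the circle
    that avoids a point. *)
Lemma circle_weierstrass (K : set C) (zeta : C) (e B : R) (phi : C -> C) :
  avoids zeta e K ->
  (forall z, K z -> cmod (phi z) <= B) ->
  (forall eta : R, 0 < eta -> exists2 delta : R, 0 < delta &
     forall z w, K z -> K w -> cmod (z - w) < delta ->
       cmod (phi z - phi w) <= eta) ->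
  forall eps : R, 0 < eps -> exists p : {poly C},
    forall z, K z -> cmod (phi z - p.[z]) <= eps.
Proof.
move=> HK HB Hc eps eps0; have [z1 e0 HK2] := HK.
have Kneq z : K z -> z != zeta.
  by move=> /HK2[_]; apply: contraTneq => ->; rewrite subrr cmod0 -ltNge.
have [delta delta0 Hdelta] := Hc (eps / 4) ltac:(lra).
have [M ME] : exists M, M = 2 / e by eexists.
have M0 : 0 < M by rewrite ME divr_gt0.
pose u z := circle_coord zeta M z.
have u01 z : K z -> 0 <= u z <= 1.
  move=> Kz; have [zz ez] := HK2 z Kz.
  have := cayley_le z1 zz e0 ez; rewrite -ME ler_norml => /andP[h1 h2].
  have M2 : 0 < 2 * M by lra.
  by rewrite /u /circle_coord; apply/andP; split;
    rewrite ?ler_pdivlMr ?ler_pdivrMr //; lra.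
have ulip z w : K z -> K w -> cmod (z - w) <= 4 * M * `|u z - u w|.
  move=> Kz Kw; have [zz _] := HK2 z Kz; have [ww _] := HK2 w Kw.
  rewrite (le_trans (cayley_inv_lip z1 zz ww (Kneq _ Kz) (Kneq _ Kw))) //.
  have -> : cayley zeta z - cayley zeta w = 2 * M * (u z - u w).
    by rewrite /u /circle_coord; field; rewrite gt_eqF.
  by rewrite normrM (ger0_norm (mulr_ge0 _ (ltW M0))) // mulrA; lra.
have d0 : 0 < delta / (8 * M) by rewrite divr_gt0 // mulr_gt0.
have e40 : 0 < eps / 4 by lra.
have [z w Kz Kw zw|P HP] := bernstein_approx u01 HB d0 e40.
  apply: Hdelta => //; rewrite (le_lt_trans (ulip _ _ Kz Kw)) //.
  have -> : delta = 4 * M * (2 * (delta / (8 * M))).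
    by field; rewrite gt_eqF.
  by rewrite ltr_pM2l // mulr_gt0.
have [L L0 HL] := poly_lip P; have L1 : 0 < L + 1 by lra.
pose e2 := Num.min 1 (eps / 2 / (L + 1)).
have e2_0 : 0 < e2 by rewrite lt_min ltr01 !divr_gt0.
have [a Ha] := circle_coord_approx HK e2_0; rewrite -ME in Ha.
exists (P \Po a) => z Kz; rewrite horner_comp.
have {}Ha := Ha z Kz; have {}HP := HP z Kz; have /andP[u0 u1] := u01 z Kz.
rewrite -/(u z) in Ha; set x := (u z)%:C%C in Ha HP.
have x1 : cmod x <= 1 by rewrite cmodr_ge0.
have e21 : e2 <= 1 by rewrite ge_min lexx.
have e22 : (L + 1) * e2 <= eps / 2.
  by rewrite mulrC -ler_pdivlMr // ge_min lexx orbT.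
have a2 : cmod a.[z] <= 2.
  by have := cmod_rev a.[z] x; rewrite (cmodB a.[z]); lra.
have h1 := HL x a.[z] ltac:(lra) a2.
have h2 : L * cmod (x - a.[z]) <= (L + 1) * e2.
  by apply: ler_pM; rewrite ?cmod_ge0 //; lra.
have := cmod_tri P.[x] (phi z) P.[a.[z]].
by rewrite (cmodB (phi z) P.[x]); lra.
Qed.

End CircleSets.

(** * Limits of polynomials on the disc *)

(** Convergence of a sequence of complex numbers, in terms of the real
    modulus. *)
Definition ccvg (R : realType) (u : nat -> R[i]) (l : R[i]) : Prop :=
  forall e : R, 0 < e -> exists N, forall n, (N <= n)%N -> cmod (u n - l) <= e.

(** The sequence of polynomials [D] converges in the Frechet space of
    holomorphic functions of the unit disc. *)
Definition disc_cauchy (R : realType) (D : nat -> {poly R[i]}) : Prop :=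
  forall s : R, 0 <= s < 1 -> forall e : R, 0 < e ->
    exists N, forall i j, (N <= i)%N -> (N <= j)%N -> pnorm s (D i - D j) <= e.

(** [F] is the limit of the polynomials [D] on the unit disc. *)
Definition disc_limit (R : realType) (D : nat -> {poly R[i]})
    (F : R[i] -> R[i]) : Prop :=
  forall z, cmod z < 1 -> ccvg (fun n => (D n).[z]) (F z).

Section Limits.
Variable R : realType.
Local Notation C := R[i].
Implicit Types (u v : nat -> C) (D : nat -> {poly C}) (F : C -> C).

Lemma ccvg_le u l (B : R) N : ccvg u l ->
  (forall n, (N <= n)%N -> cmod (u n) <= B) -> cmod l <= B.
Proof.
move=> ul uB; rewrite leNgt; apply/negP => Bl.
have [|M HM] := ul ((cmod l - B) / 2); first by lra.
have := HM (M + N)%N (leq_addr _ _); have := uB (M + N)%N (leq_addl _ _).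
by have := cmod_rev l (u (M + N)%N); rewrite (cmodB l); lra.
Qed.

Lemma ccvg_eventually u l a N : ccvg u l ->
  (forall n, (N <= n)%N -> u n = a) -> l = a.
Proof.
move=> ul ua; apply/eqP; rewrite -subr_eq0 -cmod_eq0 eq_le cmod_ge0 andbT.
apply/ler_addgt0Pl => e e0; rewrite addr0.
have [M HM] := ul e e0; have := HM (M + N)%N (leq_addr _ _).
by rewrite ua ?leq_addl // cmodB.
Qed.

Lemma ccvgB u v l m : ccvg u l -> ccvg v m -> ccvg (fun n => u n - v n) (l - m).
Proof.
move=> ul vm e e0; have e20 : 0 < e / 2 by lra.
have [N HN] := ul _ e20; have [M HM] := vm _ e20.
exists (N + M)%N => n Hn.
have -> : u n - v n - (l - m) = (u n - l) - (v n - m) by ring.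
rewrite (le_trans (cmodBD _ _)) //.
have := HN n (leq_trans (leq_addr _ _) Hn).
by have := HM n (leq_trans (leq_addl _ _) Hn); lra.
Qed.

Lemma ccvgZ u l a : ccvg u l -> ccvg (fun n => a * u n) (a * l).
Proof.
move=> ul e e0; have a0 := cmod_ge0 a; have a1 : 0 < cmod a + 1 by lra.
have [|N HN] := ul (e / (cmod a + 1)); first by rewrite divr_gt0.
exists N => n /HN; rewrite -mulrBr cmodM ler_pdivlMr // => h.
by have := cmod_ge0 (u n - l); nra.
Qed.

Lemma real_cauchy_cvg (u : nat -> R) :
  (forall e : R, 0 < e -> exists N, forall n, (N <= n)%N ->
     `|u n - u N| <= e) ->
  exists l : R, forall e : R, 0 < e -> exists N, forall n, (N <= n)%N ->
     `|u n - l| <= e.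
Proof.
move=> Hu.
have cu : cvg (u @ \oo).
  apply/cauchy_cvgP/cauchy_exP => e e0.
  have [|N HN] := Hu (e / 2); first by lra.
  exists (u N); exists N => // n /= Nn; rewrite -ball_normE /= distrC.
  by rewrite (le_lt_trans (HN n Nn)) //; lra.
exists (lim (u @ \oo)) => e e0.
have /cvgrPdist_le/(_ e e0)[N _ HN] := cu.
by exists N => n Nn; rewrite distrC; exact: HN.
Qed.

Lemma ccvg_cauchy u :
  (forall e : R, 0 < e -> exists N, forall n, (N <= n)%N ->
     cmod (u n - u N) <= e) -> exists l, ccvg u l.
Proof.
move=> Hu.
have [|a Ha] := @real_cauchy_cvg (fun n => Re (u n)).
  move=> e /Hu[N HN]; exists N => n /HN; apply: le_trans.
  by rewrite -raddfB; exact: Re_le_cmod.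
have [|b Hb] := @real_cauchy_cvg (fun n => Im (u n)).
  move=> e /Hu[N HN]; exists N => n /HN; apply: le_trans.
  by rewrite -raddfB; exact: Im_le_cmod.
exists (a +i* b)%C => e e0; have e20 : 0 < e / 2 by lra.
have [N HN] := Ha _ e20; have [M HM] := Hb _ e20.
exists (N + M)%N => n Hn; rewrite (le_trans (cmod_le_ReIm _)) //.
have := HN n (leq_trans (leq_addr _ _) Hn).
have := HM n (leq_trans (leq_addl _ _) Hn).
by case: (u n) => x y /=; lra.
Qed.

Lemma disc_limit_exists D : disc_cauchy D -> exists F, disc_limit D F.
Proof.
move=> HD; exists (fun z => xget 0 [set l | ccvg (fun n => (D n).[z]) l]).
move=> z z1; suff [l Hl] : exists l, ccvg (fun n => (D n).[z]) l.
  exact: (xgetI 0 Hl).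
apply: ccvg_cauchy => e e0.
have [|N HN] := HD (cmod z) _ e e0; first by rewrite cmod_ge0.
exists N => n Nn; rewrite -hornerN -hornerD.
by rewrite (le_trans (cmod_horner_le (cmod_ge0 z) _ (lexx _))) // HN.
Qed.

(** Differentiation is bounded from a larger radius to a smaller one. *)
Lemma pnorm_deriv (s t : R) (p : {poly C}) : 0 <= s -> s < t ->
  pnorm s p^`() <= pnorm t p / (t - s).
Proof.
move=> s0 st; have t0 : 0 <= t by lra.
have d0 : 0 < t - s by lra.
elim/poly_ind: p => [|p c IH]; first by rewrite deriv0 !pnorm0 mul0r.
rewrite derivD derivC addr0 derivM derivX mulr1 pnorm_cons //.
rewrite (le_trans (pnormD s0 _ _)) // pnormMX //.
rewrite ler_pdivlMr // in IH; rewrite ler_pdivlMr //.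
have := pnorm_le_radius s0 p (ltW st); have := cmod_ge0 c.
have := pnorm_ge0 s0 p; have := pnorm_ge0 s0 p^`().
nra.
Qed.

Lemma horner_taylor (s t : R) (p : {poly C}) (z h : C) :
  0 <= s -> s < t -> cmod z <= s -> cmod (z + h) <= s ->
  cmod (p.[z + h] - p.[z] - h * p^`().[z])
    <= cmod h ^+ 2 * (pnorm t p / (t - s) ^+ 2).
Proof.
move=> s0 st zs zhs; have t0 : 0 <= t by lra.
have d0 : 0 < t - s by lra.
elim/poly_ind: p => [|p c IH].
  by rewrite deriv0 !horner0 pnorm0 mulr0 !subr0 cmod0 mul0r mulr0.
have -> : (p * 'X + c%:P).[z + h] - (p * 'X + c%:P).[z]
    - h * (p * 'X + c%:P)^`().[z]
  = (z + h) * (p.[z + h] - p.[z] - h * p^`().[z]) + h ^+ 2 * p^`().[z].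
  by rewrite derivD derivC addr0 derivM derivX mulr1 !hornerE; ring.
rewrite (le_trans (cmodD _ _)) // (cmodM (z + h)) (cmodM (h ^+ 2)) cmodX.
rewrite pnorm_cons //.
set E := cmod (p.[z + h] - _ - _) in IH *.
have h1 : cmod (z + h) * E <= s * (cmod h ^+ 2 * (pnorm t p / (t - s) ^+ 2)).
  by apply: ler_pM; rewrite ?cmod_ge0.
have h2 : cmod h ^+ 2 * cmod p^`().[z] <= cmod h ^+ 2 * (pnorm t p / (t - s)).
  rewrite ler_wpM2l ?sqr_ge0 //.
  exact: le_trans (cmod_horner_le s0 _ zs) (pnorm_deriv _ s0 st).
rewrite (le_trans (lerD h1 h2)) //.
have -> : s * (cmod h ^+ 2 * (pnorm t p / (t - s) ^+ 2))
    + cmod h ^+ 2 * (pnorm t p / (t - s))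
  = cmod h ^+ 2 * (t * pnorm t p / (t - s) ^+ 2).
  by field; rewrite gt_eqF.
rewrite ler_wpM2l ?sqr_ge0 // ler_wpM2r ?invr_ge0 ?sqr_ge0 //.
by rewrite lerDl cmod_ge0.
Qed.

Lemma disc_cauchy_deriv D : disc_cauchy D -> disc_cauchy (fun n => (D n)^`()).
Proof.
move=> HD s /andP[s0 s1] e e0; pose t := (1 + s) / 2.
have st : s < t by rewrite /t; lra.
have [||N HN] := HD t _ (e * (t - s)); first by apply/andP; rewrite /t; lra.
  by rewrite mulr_gt0 // subr_gt0.
exists N => i j Ni Nj; rewrite -derivB (le_trans (pnorm_deriv _ s0 st)) //.
by rewrite ler_pdivrMr ?subr_gt0 // HN.
Qed.

Lemma disc_cauchy_derivn D k : disc_cauchy D ->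
  disc_cauchy (fun n => (D n)^`(k)).
Proof.
move=> HD; elim: k => [|k IH].
  by have -> : (fun n => (D n)^`(0)) = D by apply/funext => n.
have -> : (fun n => (D n)^`(k.+1)) = (fun n => ((D n)^`(k))^`()).
  by apply/funext => n; rewrite derivnS.
exact: disc_cauchy_deriv.
Qed.

(** Differentiability from a quadratic remainder. *)
Lemma is_derive_quadratic (F : R[i]^o -> R[i]^o) (z g : R[i]^o) (L d : R) :
  0 < d -> (forall h : C, cmod h < d ->
    cmod (F (z + h) - F z - h * g) <= L * cmod h ^+ 2) ->
  is_derive z 1 F g.
Proof.
move=> d0 HL.
suff cv : h^-1 *: (F (h *: 1 + z) - F z) @[h --> (0 : R[i]^o)^'] --> g.
  by apply: DeriveDef; [apply: cvgP cv|exact/cvg_lim].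
apply/cvgrPdist_le => e e0.
have eE : e = (Re e)%:C%C by rewrite RRe_real // gtr0_real.
have re0 : 0 < Re e by rewrite -ltcR -eE.
have L0 : 0 < `|L| + 1 by have := normr_ge0 L; lra.
pose d1 := Num.min d (Re e / (`|L| + 1)).
have d10 : 0 < d1 by rewrite lt_min d0 divr_gt0.
near=> h.
have h0 : h != 0 by near: h; exact: (@nbhs_dnbhs_neq _ (0 : R[i]^o)).
have hd : cmod h < d1.
  rewrite -norm_lt; near: h; apply: (@dnbhs0_lt _ R[i]^o).
  by rewrite ltcR.
have hd' : cmod h < d by rewrite (lt_le_trans hd) // ge_min lexx.
have he : cmod h * (`|L| + 1) <= Re e.
  by rewrite -ler_pdivlMr // (le_trans (ltW hd)) // ge_min lexx orbT.
rewrite eE normE lecR.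
have -> : g - h^-1 *: (F (h *: 1 + z) - F z)
  = - (h^-1 * (F (z + h) - F z - h * g)).
  have -> : h *: 1 + z = z + h by rewrite addrC /GRing.scale /= mulr1.
  by rewrite /GRing.scale /=; field.
rewrite cmodN cmodM cmodV ler_pdivrMl ?cmod_gt0 //.
rewrite (le_trans (HL h hd')) //.
have : L <= `|L| by exact: ler_norm.
have := cmod_ge0 h; nra.
Unshelve. all: by end_near. Qed.

(** Termwise differentiation: the remainders of [D n] are bounded uniformly by
    [horner_taylor]. *)
Lemma disc_limit_is_derive D F G (z : C) : disc_cauchy D -> disc_limit D F ->
  disc_limit (fun n => (D n)^`()) G -> cmod z < 1 ->
  is_derive (z : R[i]^o) 1 (F : R[i]^o -> R[i]^o) (G z).
Proof.
move=> HD HF HG z1; have z0 := cmod_ge0 z.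
pose s := (1 + cmod z) / 2; pose t := (1 + s) / 2.
have [zs [st t1]] : cmod z < s /\ s < t /\ t < 1 by rewrite /t /s; lra.
have s0 : 0 <= s by lra.
have [|N HN] := HD t _ 1 ltr01; first by apply/andP; lra.
apply: (@is_derive_quadratic _ _ _ ((pnorm t (D N) + 1) / (t - s) ^+ 2)
  (s - cmod z)); first by lra.
move=> h hd; have zh : cmod (z + h) <= s by rewrite (le_trans (cmodD _ _)) //; lra.
apply: (@ccvg_le _ _ _ N
  (ccvgB (ccvgB (HF (z + h) _) (HF z z1)) (ccvgZ h (HG z z1)))); first by lra.
move=> n Nn; rewrite (le_trans (horner_taylor _ s0 st (ltW zs) zh)) // mulrC.
rewrite ler_wpM2r ?sqr_ge0 // ler_wpM2r ?invr_ge0 ?sqr_ge0 //.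
have -> : D n = D N + (D n - D N) by ring.
have t0 : 0 <= t by lra.
by rewrite (le_trans (pnormD t0 _ _)) // lerD2l HN.
Qed.

Lemma disc_limit_holo D F : disc_cauchy D -> disc_limit D F ->
  holo_disc (F : R[i]^o -> R[i]^o).
Proof.
move=> HD HF z; rewrite /unit_disc /= normE ltcR => z1.
have [G HG] := disc_limit_exists (disc_cauchy_deriv HD).
by have [] := disc_limit_is_derive HD HF HG z1.
Qed.

Lemma disc_limit_derive1n D F k : disc_cauchy D -> disc_limit D F ->
  disc_limit (fun n => (D n)^`(k))
    ((F : R[i]^o -> R[i]^o)^`(k))%classic.
Proof.
move=> HD HF; elim: k => [|k IH] //.
have [G HG] := disc_limit_exists (disc_cauchy_deriv (disc_cauchy_derivn k HD)).
move=> z z1.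
have -> : ((F : R[i]^o -> R[i]^o)^`(k.+1))%classic z = G z.
  rewrite derive1nS derive1E.
  by apply: (@derive_val _ _ _ _ _ _ _
    (disc_limit_is_derive (disc_cauchy_derivn k HD) IH HG z1)).
have -> : (fun n => ((D n)^`(k.+1)).[z]) = (fun n => ((D n)^`(k)^`()).[z]).
  by apply/funext => n; rewrite derivnS.
exact: HG.
Qed.

Lemma disc_limit_taylor_coef D F k : disc_cauchy D -> disc_limit D F ->
  ccvg (fun n => (D n)`_k) (taylor_coef (F : R[i]^o -> R[i]^o) k).
Proof.
move=> HD HF.
have -> : (fun n => (D n)`_k) = (fun n => k`!%:R^-1 * ((D n)^`(k)).[0]).
  apply/funext => n; rewrite horner_coef0 coef_derivn addn0 ffactnn.
  rewrite -(mulr_natl (D n)`_k) mulrA mulVf ?mul1r //.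
rewrite /taylor_coef mulrC; apply: ccvgZ; apply: disc_limit_derive1n => //.
by rewrite cmod0.
Qed.

End Limits.

(** * Uniform convergence on compact sets, and countably many tasks *)

Section Topology.
Variable R : realType.
Local Notation C := R[i].
Local Notation Co := (R[i]^o).
Implicit Types (K : set Co) (phi : Co -> Co).

Lemma nbhs_cmod (x : Co) (A : set Co) :
  nbhs x A <-> exists2 r : R, 0 < r & forall y : C, cmod (y - x) < r -> A y.
Proof.
rewrite nbhs_ballP; split=> [[e /= e0 He]|[r r0 Hr]].
  exists (Re e); first by rewrite -ltcR RRe_real ?gtr0_real.
  move=> y yx; apply: He; rewrite -ball_normE /= distrC.
  by rewrite -[e]RRe_real ?gtr0_real // norm_lt.
exists (r%:C)%C => /=; first by rewrite ltcR.
move=> y; rewrite -ball_normE /= distrC norm_lt => yx; exact: Hr.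
Qed.

Lemma entourage_cmod (E : set (Co * Co)) :
  entourage E <-> exists2 r : R, 0 < r &
    forall x y : C, cmod (x - y) < r -> E (x, y).
Proof.
rewrite -entourage_ballE; split=> [[e /= e0 He]|[r r0 Hr]].
  exists (Re e); first by rewrite -ltcR RRe_real ?gtr0_real.
  move=> x y yx; apply: He; rewrite -ball_normE /=.
  by rewrite -[e]RRe_real ?gtr0_real // norm_lt.
exists (r%:C)%C => /=; first by rewrite ltcR.
by move=> [x y] /=; rewrite -ball_normE /= norm_lt => yx; exact: Hr.
Qed.

Lemma uniform_nbhs_cmod K (h : Co -> Co) (P : set (Co -> Co)) :
  nbhs (h : {uniform` K -> Co}) P <-> exists2 r : R, 0 < r &
    forall g : Co -> Co, (forall z, K z -> cmod (g z - h z) < r) -> P g.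
Proof.
rewrite uniform_nbhs; split=> [[E [/entourage_cmod[r r0 Hr] EP]]|[r r0 Hr]].
  exists r => // g Hg; apply: EP => z Kz; apply: Hr; rewrite cmodB; exact: Hg.
exists [set xy | cmod (xy.1 - xy.2) < r]; split.
  by apply/entourage_cmod; exists r.
by move=> g /= Hg; apply: Hr => z Kz; rewrite cmodB; exact: Hg.
Qed.

Lemma uniform_cvg_cmod K (g : nat -> Co -> Co) (h : Co -> Co) :
  {uniform K, g @ \oo --> h} <->
  forall e : R, 0 < e -> exists N, forall n, (N <= n)%N ->
    forall z, K z -> cmod (g n z - h z) < e.
Proof.
split=> [gh e e0|gh P /uniform_nbhs_cmod[r r0 Hr]].
  have [|N _ HN] := gh [set f | forall z, K z -> cmod (f z - h z) < e].
    by apply/uniform_nbhs_cmod; exists e.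
  by exists N => n Nn; exact: HN.
have [N HN] := gh r r0; exists N => // n /= Nn; apply: Hr => z Kz; exact: HN.
Qed.

Lemma uniform_closure_cmod K (g : nat -> Co -> Co) (h : Co -> Co) :
  closure (range g : set {uniform` K -> Co}) h <->
  forall e : R, 0 < e -> exists n, forall z, K z -> cmod (g n z - h z) < e.
Proof.
split=> [gh e e0|gh P /uniform_nbhs_cmod[r r0 Hr]].
  have [|f [[n _ <-] Hn]] := gh [set f | forall z, K z -> cmod (f z - h z) < e].
    by apply/uniform_nbhs_cmod; exists e.
  by exists n.
by have [n Hn] := gh r r0; exists (g n); split; [exists n|exact: Hr].
Qed.

(** A property that holds locally for large [n] holds on a compact set for large
    [n]. *)
Lemma compact_uniformly K (P : nat -> C -> Prop) : compact K ->
  (forall x : C, K x -> exists2 r : R, 0 < r & exists N, forall n, (N <= n)%N ->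
     forall z, cmod (z - x) < r -> P n z) ->
  exists N, forall n, (N <= n)%N -> forall z : C, K z -> P n z.
Proof.
move=> /compact_near_coveringP cK HP.
have [|N _ HN] := @cK nat \oo P _.
  move=> x /HP[r r0 [N HN]]; exists ([set z | cmod (z - x) < r], [set n | (N <= n)%N]).
    by split => /=; [apply/nbhs_cmod; exists r|exists N].
  by move=> [z n] [/= zx Nn]; exact: HN.
by exists N => n Nn z Kz; exact: HN.
Qed.

Lemma natr_inv_small (r : R) : 0 < r -> exists N : nat, forall n : nat,
  (N <= n)%N -> n.+1%:R^-1 <= r.
Proof.
move=> r0; have [N HN] := natr_mul_small 1 r0; exists N => n Nn.
rewrite invf_ple ?posrE ?ltr0n // -[_^-1]mul1r ler_pdivrMr //.
by rewrite (le_trans HN) // ler_wpM2r ?(ltW r0) // ler_nat leqW.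
Qed.

Lemma proper_compact_avoids K : proper_compact K ->
  exists (zeta : C) (e : R), avoids zeta e K.
Proof.
move=> [cK KT Kneq].
have [zeta [z1 Kz]] : exists zeta : C, cmod zeta = 1 /\ ~ K zeta.
  apply: contrapT => H; apply: Kneq; apply/seteqP; split=> // z.
  rewrite /unit_circle /= normE => /complexI z1.
  by apply: contrapT => Kz; apply: H; exists z.
have [|N HN] := @compact_uniformly K (fun n z => n.+1%:R^-1 <= cmod (z - zeta)) cK.
  move=> x Kx; have xz : 0 < cmod (x - zeta).
    by rewrite cmod_gt0 subr_eq0; apply: contra_notN Kz => /eqP <-.
  exists (cmod (x - zeta) / 2); first by lra.
  have [|N HN] := @natr_inv_small (cmod (x - zeta) / 2); first by lra.
  exists N => n /HN h z zx.
  apply: le_trans h _.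
  by have := cmod_tri z x zeta; rewrite (cmodB x z); lra.
exists zeta, N.+1%:R^-1; split => // z Kz1; split; last exact: HN.
by have := KT z Kz1; rewrite /unit_circle /= normE => /complexI.
Qed.

Lemma within_cmod K phi (x : C) (e : R) : {within K, continuous phi} -> K x ->
  0 < e -> exists2 r : R, 0 < r &
    forall z : C, K z -> cmod (z - x) < r -> cmod (phi z - phi x) < e.
Proof.
move=> /subspace_continuousP cphi Kx e0.
have := cphi x Kx [set y : Co | cmod (y - phi x) < e].
rewrite /within /= => H.
have /nbhs_cmod[r r0 Hr] : nbhs (x : Co)
    [set z : Co | K z -> cmod (phi z - phi x) < e].
  by apply: H; apply/nbhs_cmod; exists e.
by exists r => // z Kz zx; exact: Hr.
Qed.

Lemma compact_continuous_bounded K phi : compact K ->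
  {within K, continuous phi} -> exists B : R, forall z, K z -> cmod (phi z) <= B.
Proof.
move=> cK cphi.
have [|N HN] := @compact_uniformly K (fun n z => K z -> cmod (phi z) <= n%:R) cK.
  move=> x Kx; have [r r0 Hr] := within_cmod cphi Kx ltr01.
  exists r => //; have [N HN] := natr_mul_small (cmod (phi x) + 1) (@ltr01 R).
  exists N => n Nn z zx Kz; have := Hr z Kz zx.
  have := cmod_rev (phi z) (phi x); rewrite mulr1 in HN.
  by have : N%:R <= n%:R :> R by [rewrite ler_nat]; lra.
by exists N%:R => z Kz; exact: (HN N).
Qed.

Lemma compact_continuous_uniform K phi : compact K ->
  {within K, continuous phi} ->
  forall eta : R, 0 < eta -> exists2 delta : R, 0 < delta &
    forall z w : C, K z -> K w -> cmod (z - w) < delta -> cmod (phi z - phi w) <= eta.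
Proof.
move=> cK cphi eta eta0.
have [|N HN] := @compact_uniformly K (fun n z => K z -> forall w, K w ->
    cmod (z - w) < n.+1%:R^-1 -> cmod (phi z - phi w) <= eta) cK.
  move=> x Kx; have [|r r0 Hr] := within_cmod cphi Kx (e := eta / 2); first by lra.
  exists (r / 2); first by lra.
  have [|N HN] := @natr_inv_small (r / 2); first by lra.
  exists N => n /HN h z zx Kz w Kw zw.
  have h1 := Hr z Kz ltac:(lra).
  have {}zw := lt_le_trans zw h.
  have wx : cmod (w - x) < r by have := cmod_tri z w x; rewrite (cmodB w z); lra.
  have h2 := Hr w Kw wx.
  by have := cmod_tri (phi x) (phi z) (phi w); rewrite (cmodB (phi x)); lra.
by exists N.+1%:R^-1 => // z w Kz Kw zw; exact: (HN N).
Qed.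

(** Polynomials are uniformly dense in the continuous functions on a proper
    compact subset of the circle. *)
Lemma proper_compact_weierstrass K phi : proper_compact K ->
  {within K, continuous phi} -> forall e : R, 0 < e ->
  exists p : {poly C}, forall z, K z -> cmod (phi z - p.[z]) <= e.
Proof.
move=> pK cphi e e0; have [cK _ _] := pK.
have [zeta [d HK]] := proper_compact_avoids pK.
have [B HB] := compact_continuous_bounded cK cphi.
by apply: (circle_weierstrass HK HB) => //; exact: compact_continuous_uniform.
Qed.

End Topology.

(** A task is a set [K] and a polynomial target with rational data: [K] is the
    part of the circle outside of a disc with rational centre and radius. The
    first component is a label: it repeats each pair infinitely often, and its
    parity may select a variant of the approximation problem. *)
Definition task : Type := nat * (rat * rat) * rat * seq (rat * rat).

Section Tasks.
Variable R : realType.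
Local Notation C := R[i].

(** The complex number, the polynomial and the target given by rational data. *)
Definition rat_complex (q : rat * rat) : C := (ratr q.1 +i* ratr q.2)%C.

Definition rat_poly (s : seq (rat * rat)) : {poly C} :=
  Poly (map rat_complex s).

Definition task_label (t : task) : nat := t.1.1.1.

Definition task_poly (t : task) : {poly C} := rat_poly t.2.

(** The last condition does not depend on [z]: it makes the set empty unless the
    disc contains points of the circle well inside, so that some point of the
    circle is always avoided. *)
Definition task_set (t : task) : set C :=
  [set z | [/\ cmod z = 1, ratr t.1.2 <= cmod (z - rat_complex t.1.1.2) &
    exists2 zeta : C, cmod zeta = 1 &
      cmod (zeta - rat_complex t.1.1.2) < ratr t.1.2 / 2]].

(** An enumeration of the tasks. *)
Definition nth_task (j : nat) : task :=
  odflt (0%N, (0, 0), 0, [::]) (unpickle j).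

Lemma task_set_avoids t : exists (zeta : C) (e : R), avoids zeta e (task_set t).
Proof.
have [[zeta [z1 Hz]]|H] := pselect (exists zeta : C, cmod zeta = 1 /\
    cmod (zeta - rat_complex t.1.1.2) < ratr t.1.2 / 2).
  exists zeta, (ratr t.1.2 / 2); split => //.
    by have := cmod_ge0 (zeta - rat_complex t.1.1.2); lra.
  move=> z [zz hz _]; split => //.
  have := cmod_tri zeta z (rat_complex t.1.1.2).
  by lra.
exists 1, 1; split; rewrite ?cmod1 // => z [_ _ [zeta z1 hz]].
by exfalso; apply: H; exists zeta.
Qed.

Lemma rat_complex_dense (z : C) (e : R) : 0 < e ->
  exists q, cmod (z - rat_complex q) <= e.
Proof.
move=> e0; set a := Re z; set b := Im z.
have /rat_in_itvoo[p] : a - e / 2 < a + e / 2 by lra.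
rewrite in_itv /= => /andP[p1 p2].
have /rat_in_itvoo[q] : b - e / 2 < b + e / 2 by lra.
rewrite in_itv /= => /andP[q1 q2].
exists (p, q); rewrite (le_trans (cmod_le_ReIm _)) // !raddfB /=.
rewrite -/a -/b.
have : `|a - ratr p| <= e / 2 by rewrite ler_norml; apply/andP; split; lra.
have : `|b - ratr q| <= e / 2 by rewrite ler_norml; apply/andP; split; lra.
by lra.
Qed.

Lemma rat_poly_dense (p : {poly C}) (e : R) : 0 < e ->
  exists s, pnorm 1 (p - rat_poly s) <= e.
Proof.
elim/poly_ind: p e => [|p c IH] e e0.
  by exists [::]; rewrite /rat_poly /= subr0 pnorm0 ltW.
have [|s Hs] := IH (e / 2); first by lra.
have [|q Hq] := @rat_complex_dense c (e / 2); first by lra.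
exists (q :: s); rewrite /rat_poly /= cons_poly_def.
have -> : p * 'X + c%:P - (Poly [seq rat_complex i | i <- s] * 'X
    + (rat_complex q)%:P) = (p - rat_poly s) * 'X + (c - rat_complex q)%:P.
  by rewrite polyCB /rat_poly; ring.
by rewrite pnorm_cons // mul1r; lra.
Qed.

Lemma injective_unbounded (g : nat -> nat) N : injective g ->
  exists i, (N <= g i)%N.
Proof.
move=> ginj; apply: contrapT => H.
have gN i : (g i < N)%N by rewrite ltnNge; apply/negP => Ni; apply: H; exists i.
have : (#|'I_N.+1| <= #|'I_N|)%N.
  apply: (@leq_card _ _ (fun i : 'I_N.+1 => Ordinal (gN i))) => i j /(congr1 val).
  by move=> /ginj /val_inj.
by rewrite !card_ord ltnn.
Qed.

(** Every approximation problem on a part of the circle that avoids a point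
    follows from infinitely many tasks, with labels of either parity. *)
Lemma task_dense (K : set C) (zeta : C) (d e : R) (p : {poly C}) (N : nat)
    (b : bool) :
  avoids zeta d K -> 0 < e ->
  exists2 j, (N <= j)%N & [/\ odd (task_label (nth_task j)) = b,
    K `<=` task_set (nth_task j) &
    forall z, K z -> cmod (p.[z] - (task_poly (nth_task j)).[z]) <= e].
Proof.
move=> [z1 d0 HK] e0.
have [|q Hq] := @rat_complex_dense zeta (d / 8); first by lra.
have /rat_in_itvoo[r] : d / 2 < 3 * d / 4 by lra.
rewrite in_itv /= => /andP[r1 r2].
have [s Hs] := rat_poly_dense p e0.
pose t i : task := ((2 * i + b)%N, q, r, s).
have [|i Hi] := @injective_unbounded (fun i => pickle (t i)) N.
  by move=> i j /(pcan_inj pickleK) []; lia.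
exists (pickle (t i)) => //; rewrite /nth_task pickleK /=; split.
- by rewrite /task_label /t /= oddD oddM /=; case: b {t Hi}.
- move=> z Kz; have [zz dz] := HK z Kz; split => //=.
    have := cmod_tri (rat_complex q) z zeta; rewrite (cmodB (rat_complex q) zeta).
    by lra.
  by exists zeta => //=; lra.
- move=> z Kz; have [zz _] := HK z Kz.
  rewrite -hornerN -hornerD (le_trans _ Hs) //.
  by apply: cmod_horner_le; rewrite ?zz.
Qed.

End Tasks.

(** * Construction by stages *)

Lemma dependent_choice_seq (T : Type) (I : nat -> T -> Prop)
    (Q : nat -> T -> T -> Prop) (x0 : T) :
  I 0%N x0 -> (forall j x, I j x -> exists2 y, Q j x y & I j.+1 y) ->
  exists u : nat -> T, forall j, I j (u j) /\ Q j (u j) (u j.+1).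
Proof.
move=> I0 step.
have /choice[next Hnext] : forall jx : nat * T, exists y, I jx.1 jx.2 ->
    Q jx.1 jx.2 y /\ I jx.1.+1 y.
  move=> [j x]; have [Ijx|nI] := pselect (I j x); last by exists x.
  by have [y Qy Iy] := step j x Ijx; exists y.
pose u := fix u j := if j is i.+1 then next (i, u i) else x0.
have Iu j : I j (u j) by elim: j => [//|j /(Hnext (j, u j))[]].
by exists u => j; split => //; case: (Hnext (j, u j) (Iu j)).
Qed.

Section Stages.
Variable R : realType.
Local Notation C := R[i].
Implicit Types (D : nat -> {poly C}) (s : nat -> R).

(** Later stages differ from the [j]-th one by a geometric tail. *)
Lemma geometric_stages D s :
  (forall j, 0 <= s j) -> (forall j, s j <= s j.+1) ->
  (forall j, pnorm (s j) (D j.+1 - D j) <= 2^-1 ^+ j.+1) ->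
  forall j k, pnorm (s j) (D (j + k)%N - D j) <= 2^-1 ^+ j.
Proof.
move=> s0 s_incr step j k.
have s_mono a : s j <= s (j + a)%N.
  by elim: a => [|a IH]; rewrite ?addn0 // addnS (le_trans IH).
suff : pnorm (s j) (D (j + k)%N - D j) <= 2^-1 ^+ j - 2^-1 ^+ (j + k).
  have : 0 <= 2^-1 ^+ (j + k) :> R by rewrite exprn_ge0 // invr_ge0.
  by lra.
elim: k => [|k IH]; first by rewrite addn0 !subrr pnorm0.
have -> : D (j + k.+1)%N - D j
    = (D (j + k).+1 - D (j + k)%N) + (D (j + k)%N - D j).
  by rewrite addnS; ring.
rewrite (le_trans (pnormD (s0 j) _ _)) //.
have := le_trans (pnorm_le_radius (s0 j) _ (s_mono k)) (step (j + k)%N).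
by rewrite addnS !exprS; lra.
Qed.

(** The polynomials of the successive stages converge on the disc, to a
    function that stays close to the [j]-th one on the [j]-th disc. *)
Lemma stages_limit D s :
  (forall j, 0 <= s j) -> (forall j, s j <= s j.+1) ->
  (forall j, 1 - 2^-1 ^+ j <= s j.+1) ->
  (forall j, pnorm (s j) (D j.+1 - D j) <= 2^-1 ^+ j.+1) ->
  disc_cauchy D /\ exists2 F, disc_limit D F &
    forall j z, cmod z <= s j -> cmod z < 1 ->
      cmod (F z - (D j).[z]) <= 2^-1 ^+ j.
Proof.
move=> s0 s_incr s_lim step; have geo := geometric_stages s0 s_incr step.
have half : 0 <= (2^-1 : R) < 1 by lra.
have s_mono i j : (i <= j)%N -> s i <= s j.
  by move=> /subnK <-; elim: (j - i)%N => // k IH; rewrite addSn (le_trans IH).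
have DC : disc_cauchy D.
  move=> t /andP[t0 t1] e e0.
  have [N1 HN1] := exprn_small half (e := 1 - t) ltac:(lra).
  have [N2 HN2] := exprn_small half (e := e / 2) ltac:(lra).
  pose N := (N1 + N2).+1.
  have tN : t <= s N.
    by have := HN1 (N1 + N2)%N (leq_addr _ _); have := s_lim (N1 + N2)%N; lra.
  have h : 2^-1 ^+ N <= e / 2 :> R by apply: HN2; rewrite leqW // leq_addl.
  exists N => i j Ni Nj.
  have -> : D i - D j = (D i - D N) - (D j - D N) by ring.
  rewrite (le_trans (pnormB t0 _ _)) //.
  have close k : (N <= k)%N -> pnorm t (D k - D N) <= e / 2.
    move=> Nk; rewrite (le_trans (pnorm_le_radius t0 _ tN)) //.
    by rewrite -(subnKC Nk) (le_trans (geo _ _)).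
  by have := close i Ni; have := close j Nj; lra.
split=> //; have [F HF] := disc_limit_exists DC; exists F => // j z zs z1.
have h : ccvg (fun n => (D n).[z] - (D j).[z]) (F z - (D j).[z]).
  apply: ccvgB; first exact: HF.
  by move=> e e0; exists 0%N => n _; rewrite subrr cmod0 ltW.
apply: (ccvg_le (N := j) h) => n jn.
rewrite -hornerN -hornerD (le_trans (cmod_horner_le (s0 j) _ zs)) //.
by rewrite -(subnKC jn).
Qed.

Lemma scale_horner (p : {poly C}) (t : R) (z : C) : t != 0 ->
  (p \Po ((t^-1)%:C%C *: 'X)).[t%:C%C * z] = p.[z].
Proof.
move=> t0; rewrite horner_comp hornerZ hornerX mulrA -rmorphM mulVf //.
by rewrite rmorph1 mul1r.
Qed.

(** One approximation step: [D] is corrected by a polynomial of high order at 0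
    that is small on the disc of radius [t], and approaches [phi] on [r K]. *)
Lemma approximation_step (K : set C) (zeta : C) (d t r : R) (D phi : {poly C})
    (n : nat) (e : R) :
  avoids zeta d K -> 0 < t -> t < r -> r <= 1 -> 0 < e ->
  exists W : {poly C}, pnorm t (W * 'X^n) <= e /\
    forall z, K z -> cmod ((D + W * 'X^n).[r%:C%C * z] - phi.[z]) <= e.
Proof.
move=> HK t0 tr r1 e0; have r0 : r != 0 by rewrite gt_eqF //; lra.
pose A := phi \Po ((r^-1)%:C%C *: 'X) - D.
have A0 : 0 <= pnorm 1 A by exact: pnorm_ge0.
have e1 : 0 < e / (pnorm 1 A + 1) by rewrite divr_gt0 //; lra.
have eA : pnorm 1 A * (e / (pnorm 1 A + 1)) <= e.
  rewrite mulrCA ger_pMr // ler_pdivrMr ?mul1r; lra.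
have [V [HV1 HV2]] := circle_cutoff HK t0 tr r1 n e1.
have t0' := ltW t0.
exists (A * V); split.
  rewrite -mulrA (le_trans (pnormM t0' _ _)) // (le_trans _ eA) //.
  by apply: ler_pM; rewrite ?pnorm_ge0 //; apply: pnorm_le_radius => //; lra.
move=> z Kz; have [_ _ /(_ z Kz)[zz _]] := HK.
have -> : (D + A * V * 'X^n).[r%:C%C * z] - phi.[z]
    = - (A.[r%:C%C * z] * (1 - (V * 'X^n).[r%:C%C * z])).
  have <- : (phi \Po ((r^-1)%:C%C *: 'X)).[r%:C%C * z] = phi.[z].
    exact: scale_horner.
  rewrite -mulrA hornerD hornerM /A hornerD hornerN.
  by set a := (phi \Po _).[_]; set b := D.[_]; set c := (V * _).[_]; ring.
rewrite cmodN cmodM (le_trans _ eA) //.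
apply: ler_pM; rewrite ?cmod_ge0 //; last exact: HV2.
by apply: cmod_horner_le => //; rewrite cmodM zz mulr1 cmodr_ge0; lra.
Qed.

End Stages.

Section Guarded.
Variables (R : realType) (r : nat -> R).
Hypothesis r_range : forall n, 0 <= r n < 1.
Hypothesis r_cvg : r n @[n --> \oo] --> (1 : R).
Local Notation C := R[i].

Lemma radii_eventually (x : R) : x < 1 ->
  exists N, forall n, (N <= n)%N -> x <= r n.
Proof.
move=> x1; have [|N _ HN] := (cvgrPdist_le _ _).1 r_cvg (1 - x).
  by rewrite subr_gt0.
exists N => n /HN /= h; have := ler_norm (1 - r n); lra.
Qed.

(** Since [r n] tends to 1, some interval above [s] contains no [r n]. *)
Lemma radii_gap (s : R) : s < 1 ->
  exists2 t : R, s < t < 1 & forall n, r n <= s \/ t <= r n.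
Proof.
move=> s1; have [|N HN] := @radii_eventually ((1 + s) / 2); first by lra.
suff [t st Ht] : exists2 t : R, s < t <= (1 + s) / 2 &
    forall n, (n < N)%N -> r n <= s \/ t <= r n.
  exists t => [|n]; first by lra.
  case: (ltnP n N) => [/Ht//|/HN h]; right; lra.
elim: N {HN} => [|N [t /andP[st t1] Ht]]; first by exists ((1 + s) / 2); [lra|].
have [rs|rs] := leP (r N) s.
  exists t => [|n]; first by lra.
  by rewrite ltnS leq_eqVlt => /orP[/eqP ->|/Ht //]; left.
exists (Num.min t (r N)).
  by rewrite lt_min st rs /= ge_min t1.
move=> n; rewrite ltnS leq_eqVlt => /orP[/eqP ->|/Ht [|h]]; first 1 last.
- by left.
- by right; rewrite ge_min h.
- by right; rewrite ge_min lexx orbT.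
Qed.

(** A polynomial, the radius of the disc on which the later corrections are
    small, and a lower bound for their order at 0. *)
Definition stage : Type := {poly C} * R * nat.

(** The polynomial has degree less than [n], and it is bounded below at all the
    radii, with a margin for the later corrections. *)
Definition guarded_inv (j : nat) (S : stage) : Prop :=
  let: (D, s, n) := S in
  [/\ 0 < s < 1, (size D <= n)%N &
    forall i, 1 + 2^-1 ^+ j <= cmod D.[(r i)%:C%C]].

(** The [j]-th task is solved on a circle of radius [x] between [s] and [s'] when
    its label is odd, and by a partial sum on the unit circle otherwise. *)
Definition guarded_step (j : nat) (S S' : stage) : Prop :=
  let: (D, s, n) := S in let: (D', s', n') := S' in
  let t := nth_task j in
  [/\ (exists W, D' = D + W * 'X^n) /\ (n < n')%N,
      pnorm s (D' - D) <= 2^-1 ^+ j.+1,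
      s <= s' /\ 1 - 2^-1 ^+ j <= s' &
      if odd (task_label t) then
        exists2 x : R, s < x <= s' & forall z, @task_set R t z ->
          cmod (D'.[x%:C%C * z] - (@task_poly R t).[z]) <= 2^-1 ^+ j.+1
      else
        exists2 m, (n <= m < n')%N & forall z, @task_set R t z ->
          cmod (\sum_(0 <= k < m.+1) D'`_k * z ^+ k - (@task_poly R t).[z])
            <= 2^-1 ^+ j.+1].

Lemma guarded_next j S : guarded_inv j S ->
  exists2 S', guarded_step j S S' & guarded_inv j.+1 S'.
Proof.
case: S => [[D s] n] [/andP[s0 s1] sizeD HD].
have s0' := ltW s0.
have [t /andP[st t1] Ht] := radii_gap s1.
have [e eE] : exists e : R, e = 2^-1 ^+ j.+1 by eexists.
have e0 : 0 < e by rewrite eE exprn_gt0 // invr_gt0.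
have e2 : 2^-1 ^+ j = 2 * e :> R by rewrite eE exprS; field.
have [rho rhoE] : exists rho, rho = (s + t) / 2 by eexists.
have [srho rhot] : s < rho /\ rho < t by rewrite rhoE; split; lra.
have rho0 : 0 < rho by lra.
set T := nth_task j.
pose x := if odd (task_label T) then rho else 1.
have [sx x1] : s < x /\ x <= 1 by rewrite /x; case: ifP; split; lra.
have [zeta [d HK]] := @task_set_avoids R T.
have [|W [HW1 HW2]] := approximation_step D (@task_poly R T) n HK s0 sx x1
  (e := e / 3); first by lra.
set E := D + W * 'X^n in HW2.
have E0 : 0 <= pnorm 1 E by exact: pnorm_ge0.
(* the guard monomial is e / 3 at rho, and exceeds E by 2 from t on *)
have [N HN] := @exprn_large R (t / rho) ((pnorm 1 E + 2) * (3 / e))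
  ltac:(by rewrite ltr_pdivlMr // mul1r).
have [l [Nl El nl]] : exists l, [/\ (N <= l)%N, (size E <= l)%N & (n <= l)%N].
  by exists (N + size E + n)%N; rewrite leq_addl -addnA leq_addr addnCA leq_addr.
have [m mE] : exists m, m = l.+1 by eexists.
have {}El : (size E <= m)%N by rewrite mE leqW.
have {}HN : (pnorm 1 E + 2) * (3 / e) <= (t / rho) ^+ m.
  by apply: HN; rewrite mE leqW.
have rm0 : 0 < rho ^+ m by rewrite exprn_gt0.
have [c cE] : exists c, c = e / 3 / rho ^+ m by eexists.
have c0 : 0 <= c by rewrite cE !divr_ge0 // ?ltW.
have crho : c * rho ^+ m = e / 3 by rewrite cE divfK // gt_eqF.
have ct : pnorm 1 E + 2 <= c * t ^+ m.
  have -> : c * t ^+ m = e / 3 * (t / rho) ^+ m by rewrite cE expr_div_n; field; rewrite gt_eqF.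
  have e30 : 0 < e / 3 by lra.
  have := ler_wpM2l (ltW e30) HN.
  have -> : e / 3 * ((pnorm 1 E + 2) * (3 / e)) = pnorm 1 E + 2.
    by field; rewrite gt_eqF.
  by [].
have cs : pnorm s (c%:C%C *: 'X^m) <= e / 3.
  rewrite pnormZ // pnormXn // cmodr_ge0 // -crho ler_wpM2l //.
  by rewrite lerXn2r ?nnegrE //; lra.
pose D' := E + c%:C%C *: 'X^m.
have D'D : pnorm s (D' - D) <= 2^-1 ^+ j.+1.
  have -> : D' - D = W * 'X^n + c%:C%C *: 'X^m by rewrite /D' /E; ring.
  by rewrite -eE (le_trans (pnormD s0' _ _)) //; lra.
exists (D', Num.max t (1 - 2^-1 ^+ j), m.+1).
  split => //.
  - split; last by rewrite mE ltnS leqW.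
    exists (W + c%:C%C *: 'X^(m - n)).
    rewrite mulrDl -scalerAl -exprD subnK ?addrA //.
    by rewrite mE leqW.
  - by rewrite !le_max (ltW st) lexx orbT.
  - rewrite -/T -eE; case: ifP => oddT.
      exists rho => [|z Kz]; first by rewrite srho le_max (ltW rhot).
      have := HW2 z Kz; rewrite /x oddT => h.
      have [_ _ /(_ z Kz)[zz _]] := HK.
      have -> : D'.[rho%:C%C * z] - (@task_poly R T).[z]
          = (E.[rho%:C%C * z] - (@task_poly R T).[z]) + c%:C%C * (rho%:C%C * z) ^+ m.
        by rewrite /D' hornerD hornerZ hornerXn; ring.
      rewrite (le_trans (cmodD _ _)) // cmodM cmodX cmodM zz mulr1.
      by rewrite !cmodr_ge0 // ?crho; lra.
    exists l => [|z Kz]; first by rewrite nl mE ltnS leqnSn.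
    have := HW2 z Kz; rewrite /x oddT rmorph1 mul1r.
    rewrite (horner_coef_wide _ El) big_mkord.
    have -> : \sum_(k < l.+1) D'`_k * z ^+ k = \sum_(k < m) E`_k * z ^+ k.
      rewrite -mE; apply: eq_bigr => k _; rewrite /D' coefD coefZ coefXn ltn_eqF ?mulr0 ?addr0 //.
    by lra.
split.
- rewrite lt_max gt_max t1 /= (lt_trans s0 st) /=.
  by rewrite e2; lra.
- rewrite (leq_trans (size_polyD _ _)) // geq_max (leq_trans El) //.
  by rewrite (leq_trans (size_scale_leq _ _)) // size_polyXn.
move=> i; have /andP[ri0 ri1] := r_range i.
have ri : cmod (r i)%:C%C = r i by rewrite cmodr_ge0.
have [ris|tri] := Ht i.
  have := HD i; have h : cmod (D' - D).[(r i)%:C%C] <= e.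
    by rewrite eE; apply: le_trans D'D; apply: cmod_horner_le; rewrite ?ri.
  rewrite hornerD hornerN in h.
  have := cmod_rev D.[(r i)%:C%C] D'.[(r i)%:C%C].
  by rewrite (cmodB D.[_] D'.[_]) -eE e2; lra.
have hE : cmod E.[(r i)%:C%C] <= pnorm 1 E.
  by apply: cmod_horner_le; rewrite ?ri // ltW.
have : cmod (c%:C%C * (r i)%:C%C ^+ m) <= cmod D'.[(r i)%:C%C] + cmod E.[(r i)%:C%C].
  have -> : c%:C%C * (r i)%:C%C ^+ m = D'.[(r i)%:C%C] - E.[(r i)%:C%C].
    by rewrite /D' hornerD hornerZ hornerXn; ring.
  exact: cmodBD.
rewrite cmodM cmodX ri cmodr_ge0 // => h.
have h2 : c * t ^+ m <= c * r i ^+ m.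
  by rewrite ler_wpM2l // lerXn2r ?nnegrE //; lra.
have : (2^-1 : R) ^+ j.+1 <= 1 by rewrite exprn_ile1 ?invr_ge0 // invf_le1 //; lra.
by lra.
Qed.

Lemma guarded_stages : exists (u : nat -> stage),
  forall j, guarded_inv j (u j) /\ guarded_step j (u j) (u j.+1).
Proof.
apply: (@dependent_choice_seq stage guarded_inv guarded_step (2%:P, 2^-1, 1%N)).
  split; [by lra|exact: size_polyC_leq1|].
  by move=> i; rewrite hornerC cmod_nat expr0; lra.
by move=> j S /guarded_next[S' ? ?]; exists S'.
Qed.

End Guarded.

(** * Universality of the limits *)

(** The functions [z |-> F (rho z)], with [rho] in [P] and as close to 1 as
    desired, approach every polynomial on each part of the circle that avoids a
    point. *)
Definition radially_dense (R : realType) (P : set R) (F : R[i] -> R[i]) : Prop :=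
  forall (K : set R[i]) (zeta : R[i]) (d : R), avoids zeta d K ->
  forall (p : {poly R[i]}) (e : R), 0 < e ->
  exists rho : R, [/\ 1 - e <= rho, 0 <= rho < 1, P rho &
    forall z, K z -> cmod (F (rho%:C%C * z) - p.[z]) <= e].

Section Universality.
Variable R : realType.
Local Notation C := R[i].
Local Notation Co := (R[i]^o).

Lemma half_pow_small (e : R) : 0 < e -> exists N, forall n, (N <= n)%N ->
  2^-1 ^+ n <= e.
Proof. by apply: exprn_small; lra. Qed.

Lemma half_pow_gt0 n : 0 < 2^-1 ^+ n :> R.
Proof. by rewrite exprn_gt0 // invr_gt0. Qed.

Lemma radially_dense_continuous (P : set R) (F : Co -> Co) (K : set Co)
    (h : Co -> Co) (e : R) :
  radially_dense P F -> proper_compact K -> continuous_on K h -> 0 < e ->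
  exists rho : R, [/\ 1 - e <= rho, 0 <= rho < 1, P rho &
    forall z : C, K z -> cmod (F (rho%:C%C * z) - h z) < e].
Proof.
move=> HF pK ch e0; have [zeta [d HK]] := proper_compact_avoids pK.
have e40 : 0 < e / 4 by lra.
have [p Hp] := proper_compact_weierstrass pK ch e40.
have [rho [rho_e rho1 Prho Hrho]] := HF _ _ _ HK p _ e40.
exists rho; split => //; first by lra.
move=> z Kz; have h1 := Hrho z Kz; have h2 := Hp z Kz.
have := cmod_tri p.[z] (F (rho%:C%C * z)) (h z).
by rewrite (cmodB p.[z] (h z)); lra.
Qed.

Lemma radially_dense_Abel (P : set R) (F : Co -> Co) :
  holo_disc F -> radially_dense P F -> Abel_universal F.
Proof.
move=> holoF HF; split=> // K pK h ch.
have step n : exists rho : R, [/\ 1 - 2^-1 ^+ n <= rho, 0 <= rho < 1 &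
    forall z : C, K z -> cmod (F (rho%:C%C * z) - h z) < 2^-1 ^+ n].
  have [rho [? ? ? ?]] := radially_dense_continuous HF pK ch (half_pow_gt0 n).
  by exists rho; split.
have [rho Hrho] := choice step; exists rho; split.
- by move=> n; case: (Hrho n).
- apply/cvgrPdist_le => e e0; have [N HN] := half_pow_small e0.
  exists N => // n /= Nn; have [h1 /andP[_ h2] _] := Hrho n.
  rewrite ger0_norm; last by lra.
  by have := HN n Nn; lra.
- apply/uniform_cvg_cmod => e e0; have [N HN] := half_pow_small e0.
  exists N => n Nn z Kz; have [_ _ hz] := Hrho n.
  exact: lt_le_trans (hz z Kz) (HN n Nn).
Qed.

Lemma radially_dense_Abel_along (r : nat -> R) (F : Co -> Co) :
  holo_disc F -> radially_dense (range r) F -> Abel_universal_along r F.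
Proof.
move=> holoF HF; split=> // K pK h ch; apply/uniform_closure_cmod => e e0.
have [_ [_ _ [n _ <-] Hn]] := radially_dense_continuous HF pK ch e0.
by exists n.
Qed.

Lemma proper_compact_set1 : proper_compact ([set 1] : set Co).
Proof.
split; first exact: compact_set1.
  by move=> z /= ->; rewrite /unit_circle /= normr1.
move=> /seteqP[_ /(_ (-1))]; rewrite /unit_circle /= normrN normr1.
move=> /(_ erefl) /(congr1 (fun z => cmod (z - 1))).
rewrite subrr cmod0 -opprD cmodN (cmod_nat _ 2) => h.
by have : (0 : R) < 2 by []; rewrite h ltxx.
Qed.

(** The coefficients below [n j] are final at stage [j]. *)
Lemma taylor_coef_stages (D : nat -> {poly C}) (n : nat -> nat) (F : Co -> Co) :
  disc_cauchy D -> disc_limit D F ->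
  (forall j, exists W, D j.+1 = D j + W * 'X^(n j)) ->
  (forall j, (n j <= n j.+1)%N) ->
  forall j k, (k < n j)%N -> taylor_coef F k = (D j)`_k.
Proof.
move=> DC HF HD n_incr j k kn.
apply: (ccvg_eventually (N := j) (disc_limit_taylor_coef k DC HF)) => i ji.
rewrite -(subnKC ji); elim: (i - j)%N => [|l IH]; first by rewrite addn0.
have [W HW] := HD (j + l)%N; rewrite addnS HW coefD IH coefMXn.
have -> : (k < n (j + l))%N; last by rewrite addr0.
apply: (leq_trans kn); elim: (l) => [|a IHa]; first by rewrite addn0.
by rewrite addnS (leq_trans IHa).
Qed.

(** The tasks with an odd label produce universality on circles. *)
Lemma stages_radially_dense (P : set R) (D : nat -> {poly C}) (s : nat -> R)
    (F : C -> C) :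
  (forall j, 0 <= s j) -> (forall j, s j < 1) ->
  (forall j, 1 - 2^-1 ^+ j <= s j.+1) ->
  (forall j z, cmod z <= s j -> cmod z < 1 ->
     cmod (F z - (D j).[z]) <= 2^-1 ^+ j) ->
  (forall j, odd (task_label (nth_task j)) ->
     exists x : R, [/\ s j < x <= s j.+1, P x & forall z,
       task_set (nth_task j) z ->
       cmod ((D j.+1).[x%:C%C * z] - (task_poly R (nth_task j)).[z])
         <= 2^-1 ^+ j.+1]) ->
  radially_dense P F.
Proof.
move=> s0 s1 s_lim HFD Hx K zeta d HK p e e0; have e40 : 0 < e / 4 by lra.
have [N HN] := half_pow_small e40.
have [[//|j] jN [odd_j Kj pj]] := task_dense p N.+1 true HK e40.
have [x [/andP[sx xs] Px {}Hx]] := Hx _ odd_j.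
have Nj : 2^-1 ^+ j <= e / 4 by apply: HN.
have Nj2 : 2^-1 ^+ j.+2 <= e / 4 by apply: HN; rewrite leqW // leqW.
exists x; split => //.
- by have := s_lim j; lra.
- by have := s0 j.+1; have := s1 j.+2; lra.
move=> z Kz; have [_ _ /(_ z Kz)[zz _]] := HK.
have xz : cmod (x%:C%C * z) = x.
  by rewrite cmodM zz mulr1 cmodr_ge0 //; have := s0 j.+1; lra.
have h1 := HFD j.+2 (x%:C%C * z) ltac:(by rewrite xz)
  ltac:(by rewrite xz; have := s1 j.+2; lra).
have h2 := Hx z (Kj z Kz); have h3 := pj z Kz.
have h4 := cmod_tri (D j.+2).[x%:C%C * z] (F (x%:C%C * z)) p.[z].
have h5 := cmod_tri (task_poly R (nth_task j.+1)).[z] (D j.+2).[x%:C%C * z] p.[z].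
by rewrite (cmodB (task_poly R _).[z] p.[z]) in h5; lra.
Qed.

(** The limit of the guarded stages: it is universal for its values on circles
    and for its Taylor polynomials, yet does not come near 0 at the radii
    [r n]. *)
Lemma guarded_function (r : nat -> R) :
  (forall n, 0 <= r n < 1) -> r n @[n --> \oo] --> (1 : R) ->
  exists F : Co -> Co, [/\ holo_disc F, radially_dense setT F,
    Taylor_universal F & forall i, 1 <= cmod (F (r i)%:C%C)].
Proof.
move=> r_range r_cvg.
have [u Hu] := guarded_stages r_range r_cvg.
pose D j := (u j).1.1; pose s j := (u j).1.2; pose n j := (u j).2.
have inv j : [/\ 0 < s j < 1, (size (D j) <= n j)%N &
    forall i, 1 + 2^-1 ^+ j <= cmod (D j).[(r i)%:C%C]].
  by have [] := Hu j; rewrite /s /D /n; case: (u j) => [[? ?] ?].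
have stp j : guarded_step j (D j, s j, n j) (D j.+1, s j.+1, n j.+1).
  have [_] := Hu j; rewrite /s /D /n.
  by case: (u j) => [[? ?] ?]; case: (u j.+1) => [[? ?] ?].
have s0 j : 0 <= s j by have [/andP[/ltW]] := inv j.
have s1 j : s j < 1 by have [/andP[]] := inv j.
have s_incr j : s j <= s j.+1 by have [_ _ [? _] _] := stp j.
have s_lim j : 1 - 2^-1 ^+ j <= s j.+1 by have [_ _ [_ ?] _] := stp j.
have n_incr j : (n j < n j.+1)%N by have [[_ ?] _ _ _] := stp j.
have s_stp j : pnorm (s j) (D j.+1 - D j) <= 2^-1 ^+ j.+1.
  by have [_ ? _ _] := stp j.
have [DC [F HF HFD]] := stages_limit s0 s_incr s_lim s_stp.
have nj j : (j <= n j)%N.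
  by elim: j => // j IH; rewrite (leq_ltn_trans IH).
exists F; split.
- exact: disc_limit_holo DC HF.
- apply: (stages_radially_dense s0 s1 s_lim HFD) => j odd_j.
  by have [_ _ _] := stp j; rewrite odd_j => -[x ? ?]; exists x; split.
- split; first exact: disc_limit_holo DC HF.
  move=> K pK phi cphi; have [zeta [d HK]] := proper_compact_avoids pK.
  have close k M : exists2 m, (M < m)%N &
      forall z : C, K z -> cmod (taylor_sum F m z - phi z) < 2^-1 ^+ k.
    have e40 : 0 < 2^-1 ^+ k / 4 :> R by have := half_pow_gt0 k; lra.
    have [p Hp] := proper_compact_weierstrass pK cphi e40.
    have [N HN] := half_pow_small e40.
    have [j jN [odd_j Kj pj]] := task_dense p (N + M).+1 false HK e40.
    have [_ _ _] := stp j; rewrite odd_j => -[m /andP[nm mn] Hm].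
    exists m.
      by apply: (leq_trans _ nm); apply: leq_trans (nj j); lia.
    move=> z Kz.
    have -> : taylor_sum F m z = \sum_(0 <= i < m.+1) (D j.+1)`_i * z ^+ i.
      apply: eq_big_nat => i /andP[_ im]; congr (_ * _).
      apply: (taylor_coef_stages (n := n) DC HF) => [l|l|].
      - by have [[? _] _ _ _] := stp l.
      - exact: ltnW.
      - by rewrite (leq_ltn_trans _ mn) // -ltnS.
    have h1 := Hm z (Kj z Kz); have h2 := pj z Kz; have h3 := Hp z Kz.
    have h4 : 2^-1 ^+ j.+1 <= 2^-1 ^+ k / 4 :> R by apply: HN; lia.
    set S := \sum_(0 <= i < _) _ in h1 *.
    have h5 := cmod_tri (task_poly R (nth_task j)).[z] S (phi z).
    have h6 := cmod_tri p.[z] (task_poly R (nth_task j)).[z] (phi z).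
    rewrite (cmodB (task_poly R _).[z] p.[z]) (cmodB p.[z] (phi z)) in h6.
    by have := half_pow_gt0 k; lra.
  have [m0 _ Hm0] := close 0%N 0%N.
  have [||lam Hlam] := @dependent_choice_seq nat
      (fun k m => forall z : C, K z -> cmod (taylor_sum F m z - phi z) < 2^-1 ^+ k)
      (fun _ m m' => (m < m')%N) m0.
  + exact: Hm0.
  + by move=> k m _; have [m' ? ?] := close k.+1 m; exists m'.
  exists lam; split.
    by apply: homo_ltn; [exact: ltn_trans|move=> k; case: (Hlam k)].
  apply/uniform_cvg_cmod => e e0; have [N HN] := half_pow_small e0.
  exists N => k Nk z Kz; have [h _] := Hlam k.
  exact: lt_le_trans (h z Kz) (HN k Nk).
- move=> i; have /andP[ri0 ri1] := r_range i.
  have ri : cmod (r i)%:C%C = r i by rewrite cmodr_ge0.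
  apply/ler_addgt0Pl => e e0.
  have [N HN] := HF (r i)%:C%C ltac:(by rewrite ri) e e0.
  have := HN N (leqnn N); have [_ _ /(_ i)] := inv N.
  have := half_pow_gt0 N.
  have := cmod_rev (D N).[(r i)%:C%C] (F (r i)%:C%C).
  by lra.
Qed.

Lemma not_Abel_along (r : nat -> R) (F : Co -> Co) :
  (forall i, 1 <= cmod (F (r i)%:C%C)) -> ~ Abel_universal_along r F.
Proof.
move=> HF [_ /(_ _ proper_compact_set1 (fun=> 0))].
have c0 : continuous_on ([set 1] : set Co) (fun=> 0 : Co).
  by apply: continuous_subspaceT; exact: cst_continuous.
move=> /(_ c0) /uniform_closure_cmod /(_ 1 ltr01) [n /(_ 1 erefl)].
by rewrite mulr1 subr0 ltNge HF.
Qed.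

End Universality.

(** * Large partial sums *)

Section Shielded.
Variable R : realType.
Local Notation C := R[i].
Local Notation Co := (R[i]^o).
Implicit Types p q : {poly C}.

(** Partial sums, and sums of partial sums, at the point 1. *)
Definition psum (k : nat) (p : {poly C}) : C := \sum_(0 <= i < k.+1) p`_i.

Definition csum (k : nat) (p : {poly C}) : C := \sum_(0 <= j < k.+1) psum j p.

(** Both the partial sum and the Cesaro mean of order [k] have modulus at least 1
    at the point 1. *)
Definition shielded (k : nat) (p : {poly C}) : Prop :=
  1 <= cmod (psum k p) /\ k.+1%:R <= cmod (csum k p).

Lemma psum_ext k p q : (forall i, (i <= k)%N -> p`_i = q`_i) ->
  psum k p = psum k q.
Proof.
by move=> pq; apply: eq_big_nat => i /andP[_ ik]; apply: pq; rewrite -ltnS.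
Qed.

Lemma csum_ext k p q : (forall i, (i <= k)%N -> p`_i = q`_i) ->
  csum k p = csum k q.
Proof.
move=> pq; apply: eq_big_nat => j /andP[_ jk]; apply: psum_ext => i ij.
by apply: pq; rewrite (leq_trans ij).
Qed.

Lemma shielded_ext k p q : (forall i, (i <= k)%N -> p`_i = q`_i) ->
  shielded k p -> shielded k q.
Proof. by move=> pq; rewrite /shielded (psum_ext pq) (csum_ext pq). Qed.

(** Each of the two conditions excludes at most one of three values. *)
Lemma avoid_two_discs (x y : C) (h : R) : 1 <= h ->
  exists2 c : nat, (c <= 2)%N &
    1 <= cmod (x + (3 * h * c%:R)%:C%C) /\ h <= cmod (y + (3 * h * c%:R)%:C%C).
Proof.
move=> h1.
have far (z : C) (l : R) (a b : nat) : l <= h -> (a < b)%N ->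
    cmod (z + (3 * h * a%:R)%:C%C) < l -> l <= cmod (z + (3 * h * b%:R)%:C%C).
  move=> lh ab za.
  have ab1 : (1 : R) <= b%:R - a%:R by rewrite -natrB ?(ltnW ab) // ler1n subn_gt0.
  have : 3 * h <= cmod ((z + (3 * h * b%:R)%:C%C) - (z + (3 * h * a%:R)%:C%C)).
    rewrite opprD addrACA subrr add0r -rmorphB cmodr -mulrBr.
    by rewrite ger0_norm; [nra|rewrite mulr_ge0; nra].
  have := cmodBD (z + (3 * h * b%:R)%:C%C) (z + (3 * h * a%:R)%:C%C).
  by lra.
have [x0|x0] := leP 1 (cmod (x + (3 * h * 0%:R)%:C%C)).
  have [y0|y0] := leP h (cmod (y + (3 * h * 0%:R)%:C%C)); first by exists 0%N.
  have [x1|x1] := leP 1 (cmod (x + (3 * h * 1%:R)%:C%C)).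
    by exists 1%N => //; split => //; apply: far y0.
  by exists 2%N => //; split; [apply: far x1|apply: far y0].
have [y1|y1] := leP h (cmod (y + (3 * h * 1%:R)%:C%C)).
  by exists 1%N => //; split => //; apply: far x0.
by exists 2%N => //; split; [apply: far x0|apply: far y1].
Qed.

(** One of three multiples of [3 (k + 1)], added to the coefficient of order [k],
    shields the order [k]: this adds the same number to both sums. *)
Lemma shield_coef (k : nat) (A : {poly C}) : exists2 c : nat, (c <= 2)%N &
  forall B : {poly C}, (forall i, (i < k)%N -> B`_i = 0) ->
    B`_k = (3 * k.+1%:R * c%:R)%:C%C -> shielded k (A + B).
Proof.
have [|c c2 [Hx Hy]] := @avoid_two_discs (psum k A) (csum k A) k.+1%:R.
  by rewrite ler1n.
exists c => // B B0 Bk.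
have pB i : (i < k)%N -> psum i (A + B) = psum i A.
  move=> ik; apply: psum_ext => l li.
  by rewrite coefD B0 ?addr0 // (leq_ltn_trans li).
have pk : psum k (A + B) = psum k A + (3 * k.+1%:R * c%:R)%:C%C.
  rewrite /psum !(big_nat_recr k) //= coefD Bk addrA; congr (_ + _ + _).
  by apply: eq_big_nat => i /andP[_ ik]; rewrite coefD B0 // addr0.
split; first by rewrite pk.
rewrite /csum (big_nat_recr k) //= pk addrA.
suff -> : \sum_(0 <= i < k) psum i (A + B) + psum k A = csum k A by [].
rewrite /csum (big_nat_recr k) //=; congr (_ + _).
by apply: eq_big_nat => i /andP[_ ik]; rewrite pB.
Qed.

(** The correction that shields the partial sums between [n] and [n + k]: its
    new coefficients are multiplied by polynomials that are small on [x K]. *)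
Lemma shield (K : set C) (zeta : C) (d : R) (A : {poly C}) (n : nat)
    (s x delta : R) (k : nat) :
  avoids zeta d K -> 0 < s -> s < x -> x <= 1 -> 0 < delta ->
  exists V : {poly C}, [/\
    pnorm s (V * 'X^n) <= \sum_(n <= i < n + k) 12 * i.+1%:R * s ^+ i,
    (forall z, K z -> cmod (V * 'X^n).[x%:C%C * z] <= delta * (1 - 2^-1 ^+ k)) &
    forall i, (n <= i < n + k)%N -> shielded i (A + V * 'X^n)].
Proof.
move=> HK s0 sx x1 delta0; have s0' := ltW s0.
elim: k => [|k [V [HV1 HV2 HV3]]].
  exists 0; split => [|z _|i].
  - by rewrite mul0r pnorm0 addn0 big_geq.
  - by rewrite mul0r horner0 cmod0 expr0 subrr mulr0.
  - by rewrite addn0; case: leqP => //= ni; rewrite ltnNge ni.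
have [c c2 Hc] := shield_coef (n + k) (A + V * 'X^n).
have [h hE] : exists h : R, h = (n + k).+1%:R by eexists.
have h0 : 0 < h by rewrite hE ltr0n.
have [eta etaE] : exists eta : R, eta = delta * 2^-1 ^+ k.+1 / (6 * h) by eexists.
have eta0 : 0 < eta.
  by rewrite etaE divr_gt0 ?mulr_gt0 ?half_pow_gt0.
have etah : 6 * h * eta = delta * 2^-1 ^+ k.+1.
  by rewrite etaE; field; rewrite gt_eqF.
have min0 : 0 < Num.min 1 eta by rewrite lt_min ltr01 eta0.
have [W [HW1 HW2]] := circle_cutoff HK s0 sx x1 1 min0.
have [a aE] : exists a : R, a = 3 * h * c%:R by eexists.
have c2R : c%:R <= 2 :> R by rewrite (ler_nat _ c 2).
have a0 : 0 <= a by rewrite aE !mulr_ge0 ?(ltW h0).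
have a6 : a <= 6 * h by rewrite aE; have : 0 <= c%:R :> R by []; nra.
pose B := a%:C%C *: ((1 - W * 'X^1) * 'X^(n + k)).
have Bcoef i : (i <= n + k)%N -> B`_i = if i == (n + k)%N then a%:C%C else 0.
  move=> ink; rewrite coefZ coefMXn; case: ltngtP ink => // [ik _|-> _].
    by rewrite mulr0.
  by rewrite subnn coefB coef1 coefMXn /= subr0 mulr1.
exists (V + a%:C%C *: ((1 - W * 'X^1) * 'X^k)).
have -> : (V + a%:C%C *: ((1 - W * 'X^1) * 'X^k)) * 'X^n = V * 'X^n + B.
  by rewrite mulrDl -scalerAl -mulrA -exprD (addnC k).
split.
- rewrite addnS big_nat_recr ?leq_addr //= (le_trans (pnormD s0' _ _)) //.
  apply: lerD => //; rewrite /B pnormZ // cmodr_ge0 // pnormMXn // -hE.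
  have h2 : pnorm s (1 - W * 'X^1) <= 2.
    rewrite (le_trans (pnormB s0' _ _)) // pnorm1.
    have := HW1; have : Num.min 1 eta <= 1 by rewrite ge_min lexx.
    by lra.
  have sk : 0 <= s ^+ (n + k) by rewrite exprn_ge0.
  rewrite mulrCA mulrC; apply: ler_wpM2r => //.
  have := pnorm_ge0 s0' (1 - W * 'X^1); nra.
- move=> z Kz; rewrite hornerD (le_trans (cmodD _ _)) //.
  have [_ _ /(_ z Kz)[zz _]] := HK.
  have h1 : cmod B.[x%:C%C * z] <= delta * 2^-1 ^+ k.+1.
    rewrite hornerZ hornerM cmodM cmodr_ge0 // cmodM -etah.
    apply: ler_pM => //; first by rewrite mulr_ge0 ?cmod_ge0.
    have g1 : cmod (1 - W * 'X^1).[x%:C%C * z] <= eta.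
      have := HW2 z Kz; rewrite hornerD hornerN -polyC1 hornerC.
      by move/le_trans; apply; rewrite ge_min lexx orbT.
    have g2 : cmod 'X^(n + k).[x%:C%C * z] <= 1.
      rewrite hornerXn cmodX cmodM zz mulr1 cmodr_ge0; last by lra.
      by rewrite exprn_ile1 //; lra.
    by rewrite -[eta]mulr1; apply: ler_pM; rewrite ?cmod_ge0.
  have h2 := HV2 z Kz.
  have -> : delta * (1 - 2^-1 ^+ k.+1)
      = delta * (1 - 2^-1 ^+ k) + delta * 2^-1 ^+ k.+1.
    by rewrite exprS; field.
  exact: lerD.
- move=> i; rewrite addnS ltnS => /andP[ni].
  rewrite leq_eqVlt => /orP[/eqP ->|ink].
    rewrite addrA; apply: Hc => [l lk|]; last by rewrite Bcoef // eqxx aE hE.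
    by rewrite Bcoef ?(ltnW lk) // ltn_eqF.
  apply: (@shielded_ext i (A + V * 'X^n)); last by apply: HV3; rewrite ni.
  move=> l li; have lnk := leq_ltn_trans li ink.
  by rewrite addrA [RHS]coefD Bcoef ?(ltnW lnk) // ltn_eqF // addr0.
Qed.

(** The corrections of [shield] from order [n] on have norm at most [e] on the
    disc of radius [s]. *)
Definition small_tail (n : nat) (s e : R) : Prop :=
  forall m, \sum_(n <= i < m) 12 * i.+1%:R * s ^+ i <= e.

Lemma small_tail_exists (s e : R) : 0 < s < 1 -> 0 < e ->
  exists N, forall n, (N <= n)%N -> small_tail n s e.
Proof.
move=> /andP[s0 s1] e0; have [t tE] : exists t, t = (1 + s) / 2 by eexists.
have [st t1] : s < t /\ t < 1 by rewrite tE; split; lra.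
have t0 : 0 < t by lra.
have [g gE] : exists g, g = (t - s) / s by eexists.
have g0 : 0 < g by rewrite gE divr_gt0 ?subr_gt0.
have ts : t = s * (1 + g) by rewrite gE; field; rewrite gt_eqF.
have bern i : 1 + i%:R * g <= (1 + g) ^+ i.
  elim: i => [|i IH]; first by rewrite mul0r addr0.
  rewrite exprS -natr1; have : 0 <= i%:R :> R by [].
  nra.
pose M := 12 * (1 + g^-1).
have M0 : 0 < M by rewrite mulr_gt0 // addr_gt0 // invr_gt0.
(* Bernoulli: i + 1 is at most a constant times (t / s) ^ i *)
have term i : 12 * i.+1%:R * s ^+ i <= M * t ^+ i.
  have si : 0 <= s ^+ i by rewrite exprn_ge0 // ltW.
  have h : 12 * i.+1%:R <= M * (1 + g) ^+ i.
    have h2 := bern i.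
    have -> : 12 * i.+1%:R = 12 * (1 + g^-1) * (1 + i%:R * g) - (12 * g^-1 + 12 * (i%:R * g)).
      by rewrite -natr1; field; rewrite gt_eqF.
    have h3 : 0 <= 12 * g^-1 + 12 * (i%:R * g).
      by rewrite addr_ge0 ?mulr_ge0 ?invr_ge0 // ltW.
    have : M * (1 + i%:R * g) <= M * (1 + g) ^+ i by rewrite ler_wpM2l // ltW.
    by rewrite /M in h3 *; lra.
  by rewrite ts exprMn [s ^+ i * _]mulrC mulrA; apply: ler_wpM2r.
have [||N HN] := @exprn_small R t (e * (1 - t) / M).
- by lra.
- by rewrite divr_gt0 // mulr_gt0 // subr_gt0.
exists N => n /HN; rewrite ler_pdivlMr // => h m.
have sumE l : (1 - t) * \sum_(n <= i < n + l) M * t ^+ i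
    = M * t ^+ n - M * t ^+ (n + l).
  elim: l => [|l IH]; first by rewrite addn0 big_geq // mulr0 subrr.
  by rewrite addnS big_nat_recr ?leq_addr //= mulrDr IH exprS; ring.
have [mn|nm] := leqP m n; first by rewrite big_geq // ltW.
have : \sum_(n <= i < m) 12 * i.+1%:R * s ^+ i <= \sum_(n <= i < m) M * t ^+ i.
  by apply: ler_sum => i _; exact: term.
have t10 : 0 < 1 - t by lra.
move=> /le_trans; apply; rewrite -(ler_pM2l t10) -(subnKC (ltnW nm)) sumE.
have : 0 <= M * t ^+ (n + (m - n)) by rewrite mulr_ge0 ?exprn_ge0 ?ltW.
by rewrite [(1 - t) * e]mulrC [M * t ^+ n]mulrC; lra.
Qed.

Section Radii.
Variable r : nat -> R.
Hypothesis r_range : forall n, 0 <= r n < 1.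
Hypothesis r_cvg : r n @[n --> \oo] --> (1 : R).

(** The order [n] is large enough for the disc of radius [s]. *)
Definition shielded_inv (j : nat) (S : stage R) : Prop :=
  let: (D, s, n) := S in 0 < s < 1 /\ small_tail n s (2^-1 ^+ j.+1 / 3).

(** The [j]-th task is solved at one of the radii [r i], and the orders between
    [n] and [n'] are shielded. *)
Definition shielded_step (j : nat) (S S' : stage R) : Prop :=
  let: (D, s, n) := S in let: (D', s', n') := S' in
  let t := nth_task j in
  [/\ (exists W, D' = D + W * 'X^n) /\ (n < n')%N,
      pnorm s (D' - D) <= 2^-1 ^+ j.+1,
      s <= s' /\ 1 - 2^-1 ^+ j <= s',
      forall k, (n <= k < n')%N -> shielded k D' &
      exists x : R, [/\ s < x <= s', range r x & forall z, task_set t z ->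
        cmod (D'.[x%:C%C * z] - (task_poly R t).[z]) <= 2^-1 ^+ j.+1]].

Lemma shielded_next j S : shielded_inv j S ->
  exists2 S', shielded_step j S S' & shielded_inv j.+1 S'.
Proof.
case: S => [[D s] n] [/andP[s0 s1] tail_s].
have [e eE] : exists e : R, e = 2^-1 ^+ j.+1 by eexists.
have e0 : 0 < e by rewrite eE half_pow_gt0.
rewrite -eE in tail_s.
have s12 : (1 + s) / 2 < 1 by lra.
have [i /(_ i (leqnn i)) ri] := radii_eventually r_cvg s12.
have /andP[ri0 ri1] := r_range i.
have [x xE] : exists x, x = r i by eexists.
rewrite -xE in ri ri0 ri1; have sx : s < x by lra.
pose s' := Num.max x (1 - 2^-1 ^+ j).
have hj := half_pow_gt0 R j.
have s'01 : 0 < s' < 1.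
  by rewrite /s' lt_max gt_max ri1 (lt_trans s0 sx) /=; lra.
have e60 : 0 < 2^-1 ^+ j.+2 / 3 :> R by rewrite divr_gt0 ?half_pow_gt0.
have [N HN] := small_tail_exists s'01 e60.
have [zeta [d HK]] := @task_set_avoids R (nth_task j).
have e30 : 0 < e / 3 by lra.
have [W [HW1 HW2]] :=
  approximation_step D (task_poly R (nth_task j)) n HK s0 sx (ltW ri1) e30.
have [V [HV1 HV2 HV3]] := shield (D + W * 'X^n) n N.+1 HK s0 sx (ltW ri1) e30.
have {}HV1 := le_trans HV1 (tail_s _).
pose D' := D + W * 'X^n + V * 'X^n.
exists (D', s', (n + N.+1)%N); last first.
  by split => //; apply: HN; rewrite addnS leqW // leq_addl.
split.
- split; last by rewrite addnS ltnS leq_addr.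
  by exists (W + V); rewrite /D' mulrDl addrA.
- have -> : D' - D = W * 'X^n + V * 'X^n by rewrite /D'; ring.
  by rewrite -eE (le_trans (pnormD (ltW s0) _ _)) //; lra.
- by rewrite !le_max (ltW sx) lexx orbT.
- by move=> k nk; exact: HV3.
- exists x; split; [by rewrite sx le_max lexx|by exists i|].
  move=> z Kz; rewrite -eE.
  have -> : D'.[x%:C%C * z] - (task_poly R (nth_task j)).[z]
    = ((D + W * 'X^n).[x%:C%C * z] - (task_poly R (nth_task j)).[z])
      + (V * 'X^n).[x%:C%C * z] by rewrite /D' [in LHS]hornerD; ring.
  rewrite (le_trans (cmodD _ _)) //.
  have := HW2 z Kz; have := HV2 z Kz; have := half_pow_gt0 R N.+1.
  nra.
Qed.

(** The limit of the shielded stages: it is universal for the radii [r n], but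
    neither its Taylor polynomials nor their arithmetic means approach 0 at
    the point 1. *)
Lemma shielded_function :
  exists F : Co -> Co, [/\ holo_disc F, radially_dense (range r) F &
    exists N, forall k, (N <= k)%N ->
      1 <= cmod (taylor_sum F k 1) /\ 1 <= cmod (cesaro_sum F k 1)].
Proof.
have half : 0 < (2^-1 : R) < 1 by lra.
have [n0 Hn0] := @small_tail_exists 2^-1 (2^-1 ^+ 1 / 3) half ltac:(lra).
have [||u Hu] :=
    @dependent_choice_seq (stage R) shielded_inv shielded_step (0, 2^-1, n0).
- by split => //; exact: Hn0.
- by move=> j S /shielded_next[S' ? ?]; exists S'.
pose D j := (u j).1.1; pose s j := (u j).1.2; pose n j := (u j).2.
have inv j : 0 < s j < 1.
  by have [] := Hu j; rewrite /s /D /n; case: (u j) => [[? ?] ?] [].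
have stp j : shielded_step j (D j, s j, n j) (D j.+1, s j.+1, n j.+1).
  have [_] := Hu j; rewrite /s /D /n.
  by case: (u j) => [[? ?] ?]; case: (u j.+1) => [[? ?] ?].
have s0 j : 0 <= s j by have /andP[/ltW] := inv j.
have s1 j : s j < 1 by have /andP[] := inv j.
have s_incr j : s j <= s j.+1 by have [_ _ [? _] _ _] := stp j.
have s_lim j : 1 - 2^-1 ^+ j <= s j.+1 by have [_ _ [_ ?] _ _] := stp j.
have n_incr j : (n j < n j.+1)%N by have [[_ ?] _ _ _ _] := stp j.
have s_stp j : pnorm (s j) (D j.+1 - D j) <= 2^-1 ^+ j.+1.
  by have [_ ? _ _ _] := stp j.
have [DC [F HF HFD]] := stages_limit s0 s_incr s_lim s_stp.
exists F; split.
- exact: disc_limit_holo DC HF.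
- apply: (stages_radially_dense s0 s1 s_lim HFD) => j _.
  by have [_ _ _ _] := stp j.
exists (n 0%N) => k n0k.
suff [j nk] : exists j, (n j <= k < n j.+1)%N.
  have [_ _ _ /(_ k nk)[Hp Hc] _] := stp j; have /andP[_ kn] := nk.
  have coefE i : (i <= k)%N -> taylor_coef F i = (D j.+1)`_i.
    move=> ik; apply: (taylor_coef_stages (n := n) DC HF) => [l|l|].
    - by have [[? _] _ _ _ _] := stp l.
    - exact: ltnW.
    - exact: leq_ltn_trans ik kn.
  have psumE i : (i <= k)%N -> taylor_sum F i 1 = psum i (D j.+1).
    move=> ik; apply: eq_big_nat => l /andP[_]; rewrite ltnS => li.
    by rewrite expr1n mulr1 coefE // (leq_trans li).
  split; first by rewrite psumE.
  have -> : cesaro_sum F k 1 = k.+1%:R^-1 * csum k (D j.+1).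
    congr (_ * _); apply: eq_big_nat => l /andP[_]; rewrite ltnS => lk.
    exact: psumE.
  by rewrite cmodM cmodV cmod_nat ler_pdivlMl ?ltr0n // mulr1.
have [m kn] : exists m, (k < n m)%N.
  exists k.+1; suff H i : (i <= n i)%N by exact: H.
  by elim: i => // i IH; rewrite (leq_ltn_trans IH).
elim: m kn => [|j IH] kn; first by rewrite ltnNge n0k in kn.
by have [/IH //|nk] := ltnP k (n j); exists j; rewrite nk.
Qed.

End Radii.

Lemma not_Taylor (F : Co -> Co) (N : nat) :
  (forall k, (N <= k)%N -> 1 <= cmod (taylor_sum F k 1)) ->
  ~ Taylor_universal F.
Proof.
move=> HF [_ /(_ _ (proper_compact_set1 R) (fun=> 0))].
have c0 : continuous_on ([set 1] : set Co) (fun=> 0 : Co).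
  by apply: continuous_subspaceT; exact: cst_continuous.
move=> /(_ c0)[lam [lam_incr /uniform_cvg_cmod /(_ 1 ltr01) [M HM]]].
have lamn n : (n <= lam n)%N.
  by elim: n => // n IH; rewrite (leq_ltn_trans IH) // lam_incr.
have := HM (M + N)%N (leq_addr _ _) 1 erefl.
by rewrite subr0 ltNge HF // (leq_trans _ (lamn _)) // leq_addl.
Qed.

Lemma not_Cesaro (F : Co -> Co) (N : nat) :
  (forall k, (N <= k)%N -> 1 <= cmod (cesaro_sum F k 1)) ->
  ~ Cesaro_universal F.
Proof.
move=> HF [_ /(_ _ (proper_compact_set1 R) (fun=> 0))].
have c0 : continuous_on ([set 1] : set Co) (fun=> 0 : Co).
  by apply: continuous_subspaceT; exact: cst_continuous.
move=> /(_ c0)[lam [lam_incr /uniform_cvg_cmod /(_ 1 ltr01) [M HM]]].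
have lamn n : (n <= lam n)%N.
  by elim: n => // n IH; rewrite (leq_ltn_trans IH) // lam_incr.
have := HM (M + N)%N (leq_addr _ _) 1 erefl.
by rewrite subr0 ltNge HF // (leq_trans _ (lamn _)) // leq_addl.
Qed.

End Shielded.

(** * Cluster sets along paths *)

Section Paths.
Variable R : realType.
Local Notation C := R[i].
Local Notation Co := (R[i]^o).

Lemma path_within (gamma : R -> Co) (a b x e : R) :
  {within `[0, 1[, continuous gamma} -> 0 <= a -> b < 1 -> x \in `[a, b] ->
  0 < e -> exists2 d : R, 0 < d & forall y : R, y \in `[a, b] ->
    `|y - x| < d -> cmod (gamma y - gamma x) < e.
Proof.
move=> /subspace_continuousP cg a0 b1 xab e0.
have sub y : y \in `[a, b] -> `[0, 1[%classic y.
  by rewrite !in_itv /= => /andP[ay yb]; rewrite in_itv /=; lra.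
have := cg x (sub x xab) [set w : Co | cmod (w - gamma x) < e].
rewrite /within /= => H.
have /nbhs_ballP[d /= d0 Hd] : nbhs x [set y | `[0, 1[%classic y ->
    cmod (gamma y - gamma x) < e].
  by apply: H; apply/nbhs_cmod; exists e.
exists d => // y yab yx; apply: Hd; last exact: sub.
by rewrite -ball_normE /= distrC.
Qed.

Lemma path_end (gamma : R -> Co) (z : Co) (e : R) :
  gamma t @[t --> (1 : R)^'-] --> z -> 0 < e ->
  exists2 d : R, 0 < d & forall t : R, 1 - d < t < 1 -> cmod (gamma t - z) < e.
Proof.
move=> gz e0; have := gz [set w : Co | cmod (w - z) < e].
rewrite /at_left /within /= => H.
have /nbhs_ballP[d /= d0 Hd] : nbhs (1 : R) [set y : R | y < 1 ->
    cmod (gamma y - z) < e].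
  by apply: H; apply/nbhs_cmod; exists e.
exists d => // t /andP[t1 t2]; apply: Hd => //.
by rewrite -ball_normE /= ger0_norm; lra.
Qed.

(** A path to the circle crosses all circles of radius close to 1, near its
    end point. *)
Lemma path_crossing (gamma : R -> Co) (z : Co) (e : R) :
  (forall t : R, 0 <= t < 1 -> cmod (gamma t) < 1) ->
  {within `[0, 1[, continuous gamma} -> cmod z = 1 ->
  gamma t @[t --> (1 : R)^'-] --> z -> 0 < e ->
  exists2 m : R, m < 1 & forall rho : R, m < rho < 1 ->
    exists t : R, [/\ 1 - e < t, 0 <= t < 1, cmod (gamma t) = rho &
      cmod (gamma t - z) < e].
Proof.
move=> g1 cg z1 gz e0.
have [d d0 Hd] := path_end gz e0.
have [t0 [t0e t0d t0_0 t01]] : exists t0, [/\ 1 - e < t0, 1 - d < t0, 0 <= t0 & t0 < 1].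
  exists (Num.max (Num.max (1 - e / 2) (1 - d / 2)) 0).
  by rewrite !lt_max !gt_max !le_max lexx !orbT; split=> //; lra.
exists (cmod (gamma t0)); first by apply: g1; rewrite t0_0.
move=> rho /andP[m_rho rho1].
have [|d1 d10 Hd1] := path_end gz (e := 1 - rho); first by lra.
have [t1 [t01' t1d t11]] : exists t1, [/\ t0 < t1, 1 - d1 < t1 & t1 < 1].
  exists (Num.max ((1 + t0) / 2) (1 - d1 / 2)).
  by rewrite !lt_max !gt_max; split; lra.
have rho_t1 : rho < cmod (gamma t1).
  have := Hd1 t1 ltac:(lra); have := cmod_rev z (gamma t1).
  by rewrite z1 (cmodB z); lra.
have cont : {within `[t0, t1], continuous (fun t => cmod (gamma t))}.
  apply/subspace_continuousP => x xab; apply/cvgrPdist_lt => eps eps0.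
  have [d2 d20 Hd2] := path_within cg t0_0 t11 xab eps0.
  apply/nbhs_ballP; exists d2 => // y; rewrite -ball_normE /= => xy yab.
  have := Hd2 y yab; rewrite distrC => /(_ xy) h.
  rewrite ltr_norml /from_subspace; have h1 := cmod_rev (gamma x) (gamma y).
  have h2 := cmod_rev (gamma y) (gamma x); rewrite (cmodB (gamma x)) in h1.
  by apply/andP; split; lra.
have [|t] := IVT (ltW t01') cont (v := rho).
  by rewrite ge_min le_max (ltW m_rho) (ltW rho_t1) orbT.
rewrite in_itv /= => /andP[t0t tt1] gt_rho.
exists t; split => //; [lra|lra|apply: Hd; lra].
Qed.

Lemma cvg_ccvg (u : nat -> Co) (l : Co) : ccvg u l -> u n @[n --> \oo] --> l.
Proof.
move=> ul A /nbhs_cmod[r r0 Hr]; have [|N HN] := ul (r / 2); first by lra.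
by exists N => // n /= /HN h; apply: Hr; lra.
Qed.

(** Only the constants among the polynomials, and only arcs [K], are used. *)
Lemma radially_dense_cluster (P : set R) (F : Co -> Co) :
  holo_disc F -> radially_dense P F -> cluster_universal F.
Proof.
move=> holoF HF; split=> // gamma [g1 cg [z zT gz]].
have z1 : cmod z = 1 by move: zT; rewrite /unit_circle /= normE => /complexI.
have {}g1 t : 0 <= t < 1 -> cmod (gamma t) < 1.
  by move=> /g1; rewrite /unit_disc /= normE ltcR.
apply/seteqP; split=> // w _.
pose K := [set y : C | cmod y = 1 /\ cmod (y - z) <= 1].
(* an arc around the end point of the path, which avoids its antipode *)
have HK : avoids (- (z : C)) 1 K.
  split; rewrite ?cmodN // => y [y1 yz]; split=> //.
  have := cmod_rev (2 * (z : C)) ((z : C) - y).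
  rewrite cmodM cmod_nat z1 mulr1 (cmodB z).
  have -> : 2 * (z : C) - ((z : C) - y) = y - - (z : C) by ring.
  by lra.
have step n : exists t : R, [/\ 1 - 2^-1 ^+ n <= t, 0 <= t < 1 &
    cmod (F (gamma t) - w) <= 2^-1 ^+ n].
  have e0 := half_pow_gt0 R n.
  have [e eE] : exists e : R, e = Num.min (2^-1 ^+ n) (1 / 2) by eexists.
  have [e_gt0 en e2] : [/\ 0 < e, e <= 2^-1 ^+ n & e <= 1 / 2].
    by rewrite eE lt_min !ge_min !lexx orbT e0; split=> //; lra.
  have [m m1 Hm] := path_crossing g1 cg z1 gz e_gt0.
  have [eta [eta0 eta_e eta_m]] : exists eta : R, [/\ 0 < eta, eta <= e & m < 1 - eta].
    exists (Num.min e ((1 - m) / 2)); split.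
    - by rewrite lt_min e_gt0 /=; lra.
    - by rewrite ge_min lexx.
    - have : Num.min e ((1 - m) / 2) <= (1 - m) / 2 by rewrite ge_min lexx orbT.
      by lra.
  have [rho [rho_eta /andP[rho0 rho1] _ Hrho]] := HF K _ _ HK (w : C)%:P eta eta0.
  have [|t [te t01 grho gtz]] := Hm rho; first by lra.
  have rho_gt0 : 0 < rho by lra.
  exists t; split => //; first by lra.
  pose y : C := (rho%:C%C)^-1 * gamma t.
  have rhoC : rho%:C%C != 0 by rewrite -cmod_gt0 cmodr_ge0.
  have gy : (gamma t : C) = rho%:C%C * y by rewrite /y mulrA divff // mul1r.
  have y1 : cmod y = 1.
    by rewrite /y cmodM cmodV cmodr_ge0 // grho mulVf // gt_eqF.
  have Ky : K y.
    split=> //.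
    have h : cmod (y - gamma t) = 1 - rho.
      have -> : y - gamma t = (1 - rho)%:C%C * y.
        by rewrite gy rmorphB rmorph1 mulrBl mul1r.
      by rewrite cmodM y1 mulr1 cmodr_ge0 //; lra.
    by have := cmod_tri (gamma t) y z; lra.
  have := Hrho y Ky; rewrite -gy hornerC; lra.
have [t Ht] := choice step; exists t; split.
- by move=> n; case: (Ht n).
- apply/cvgrPdist_le => e e0; have [N HN] := half_pow_small e0.
  exists N => // n /= Nn; have [h1 /andP[_ h2] _] := Ht n.
  by rewrite ger0_norm; [have := HN n Nn; lra|lra].
- apply: cvg_ccvg => e e0; have [N HN] := half_pow_small e0.
  exists N => n Nn; have [_ _ h] := Ht n.
  exact: le_trans h (HN n Nn).
Qed.

Lemma cluster_universal_sqr (F : Co -> Co) :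
  cluster_universal F -> cluster_universal (fun z => F (z * z)).
Proof.
move=> [holoF HF]; split.
  move=> z; rewrite /unit_disc /= => z1; apply/derivable1_diffP.
  apply: (@differentiable_comp _ _ _ _ (fun z : Co => z * z) F).
    by apply/derivable1_diffP; apply: derivableM; exact: derivable_id.
  apply/derivable1_diffP; apply: holoF; rewrite /unit_disc /= normrM.
  by rewrite -[ltRHS]mulr1 ltr_pM.
move=> gamma [g1 cg [z zT gz]]; apply: (HF (fun t => gamma t * gamma t)); split.
- move=> t /g1; rewrite /unit_disc /= normrM => h.
  by rewrite -[ltRHS]mulr1 ltr_pM.
- by move=> x; apply: cvgM; exact: cg.
- exists (z * z); last exact: cvgM.
  by move: zT; rewrite /unit_circle /= normrM => ->; rewrite mulr1.
Qed.

(** An even function cannot approach values of different signs at 1 and -1. *)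
Lemma even_not_Abel (F : Co -> Co) : ~ Abel_universal (fun z => F (z * z)).
Proof.
move=> [_ /(_ [set 1; -1])].
have pK : proper_compact ([set 1; -1] : set Co).
  split.
  - by apply: compactU; exact: compact_set1.
  - by move=> z [] /= ->; rewrite /unit_circle /= ?normrN normr1.
  move=> /seteqP[_ /(_ 'i%C)]; rewrite /unit_circle /=.
  have hi : cmod 'i%C = 1 :> R by rewrite /cmod /= expr0n /= add0r expr1n sqrtr1.
  rewrite normE hi => /(_ erefl)[] /eqP; rewrite eq_complex /=.
    by rewrite eq_sym oner_eq0.
  by rewrite eq_sym oppr_eq0 oner_eq0.
have cid : continuous_on ([set 1; -1] : set Co) id.
  by apply: continuous_subspaceT => x; exact: cvg_id.
move=> /(_ pK id cid)[rho [_ _ /uniform_cvg_cmod /(_ 1 ltr01)[N HN]]].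
have h1 := HN N (leqnn N) 1 (or_introl erefl).
have h2 := HN N (leqnn N) (-1) (or_intror erefl).
rewrite mulrN mulNr mulrN opprK in h2.
set x : C := F _ in h1 h2.
have := cmodBD (x - -1) (x - 1).
have -> : x - -1 - (x - 1) = 2 by ring.
by rewrite cmod_nat; lra.
Qed.

End Paths.

(** * Comparison of the classes *)

Theorem proposition3p4 (R : realType) (r : nat -> R)
    (r_range : forall n, 0 <= r n < 1)
    (r_cvg : r n @[n --> \oo] --> (1 : R)) :
  [/\ Abel_universal_along r `\` @Cesaro_universal R !=set0,
      @Abel_universal R `\` Abel_universal_along r !=set0,
      @cluster_universal R `\` @Abel_universal R !=set0 &
      ~ (Abel_universal_along r `<=` @Taylor_universal R) /\
      ~ (@Taylor_universal R `<=` Abel_universal_along r)].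
Proof.
have [F [holoF denseF [N sumF]]] := shielded_function r_range r_cvg.
have [G [holoG denseG taylorG lowerG]] := guarded_function r_range r_cvg.
have along_F := radially_dense_Abel_along holoF denseF.
have not_along_G := not_Abel_along lowerG.
split.
- exists F; split=> //; apply: (@not_Cesaro _ _ N) => k Nk.
  by case: (sumF k Nk).
- by exists G; split=> //; exact: radially_dense_Abel denseG.
- exists (fun z => G (z * z)); split; last exact: even_not_Abel.
  exact: cluster_universal_sqr (radially_dense_cluster holoG denseG).
- split; last by move=> /(_ _ taylorG).
  move=> /(_ _ along_F); apply: (@not_Taylor _ _ N) => k Nk.
  by case: (sumF k Nk).
Qed.
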